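(* Let $\eta\in(0,1)$. There exist constants $C,C_{h_1},C_{h_1'},C_{h_2},C_{h_3},C_{h_3'},C_{h_4},C_{h_4'}>0$ and truncation constants (in the definition of the truncation thresholds), all depending only on $\eta$, such that for all positive integers $s_1\le d_1$, $s_2\le d_2$ the following holds: if $$\mu^2\ \ge\ C\big[(\psi_{12}+\psi_{21})\wedge\phi_{12}\wedge\phi_{21}\big],$$ then the test $\Delta^*$ (defined in the context) implemented with the cutoffs $$h_1=C_{h_1}s_2\log\!\Big(1+\frac{d_2}{s_2^2}\Big),\qquad h_1'=C_{h_1'}s_1\log\!\Big(1+\frac{d_1}{s_1^2}\Big),\qquad h_2=h_2'=C_{h_2},$$ $$h_3=C_{h_3}\Big(s_2\log\!\Big(1+\frac{d_2}{s_2^2}\log\Big(e\binom{d_1}{s_1}\Big)\Big)+\log\Big(e\binom{d_1}{s_1}\Big)\Big),$$ $$h_3'=C_{h_3'}\Big(s_1\log\!\Big(1+\frac{d_1}{s_1^2}\log\Big(e\binom{d_2}{s_2}\Big)\Big)+\log\Big(e\binom{d_2}{s_2}\Big)\Big),$$ $$h_4=C_{h_4}\sqrt{\log\Big(e\binom{d_1}{s_1}\Big)},\qquad h_4'=C_{h_4'}\sqrt{\log\Big(e\binom{d_2}{s_2}\Big)}$$ satisfies $\mathcal R(\Delta^*,\mu)\le\eta$.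
   Context: Notation: $[n]=\{1,\dots,n\}$; $\mathcal P_k(n)$ is the set of subsets of $[n]$ of cardinality $k$; $a\wedge b=\min\{a,b\}$; $\mathbf 1(\cdot)$ is the indicator. Model and testing problem. Let $d_1,d_2,s_1,s_2$ be positive integers with $s_1\le d_1$, $s_2\le d_2$. One observes $\mathbf Y=\mathbf X+\mathbf E\in\mathbb R^{d_1\times d_2}$ with $\mathbf X$ deterministic and $\mathbf E$ having i.i.d. $N(0,1)$ entries; $\mathbb P_{\mathbf X}$ denotes the law of $\mathbf Y$, and $\mathbb P_0$ the law for $\mathbf X=0$. For $\mu>0$, $\Theta(s_1,s_2,d_1,d_2,\mu)$ is the set of matrices $\mathbf M\in\mathbb R^{d_1\times d_2}$ for which there exist $S_1\in\mathcal P_{s_1}(d_1)$, $S_2\in\mathcal P_{s_2}(d_2)$ with $\mathbf M_{ij}\ge\mu$ for $(i,j)\in S_1\times S_2$ and $\mathbf M_{ij}=0$ otherwise. A test is a measurable function $\Delta$ of $\mathbf Y$ with values in $\{0,1\}$; its risk is $$\mathcal R(\Delta,\mu)=\mathbb P_0(\Delta=1)+\sup_{\mathbf X\in\Theta(s_1,s_2,d_1,d_2,\mu)}\mathbb P_{\mathbf X}(\Delta=0).$$ Rate quantities. $$\psi_{12}=\tfrac1{s_1}\log\!\Big(1+\tfrac{d_2}{s_2^2}\log\big(e\tbinom{d_1}{s_1}\big)\Big),\qquad \phi_{12}=\tfrac{d_1}{s_1^2}\log\!\Big(1+\tfrac{d_2}{s_2^2}\Big),$$ $$\beta_{12}=\tfrac1{s_1s_2}\log\tbinom{d_2}{s_2}\,\mathbf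 1\Big\{\tfrac{d_1}{s_1^2}\log\big(e\tbinom{d_2}{s_2}\big)>1\Big\},$$ and $\psi_{21},\phi_{21},\beta_{21}$ are obtained by swapping $(s_1,d_1)$ with $(s_2,d_2)$. Put $\tilde R=(\psi_{12}+\beta_{21})\wedge(\psi_{21}+\beta_{12})\wedge\phi_{12}\wedge\phi_{21}$. Tests. For $\tau>0$ and $Z\sim N(0,1)$ let $\nu_\tau=\mathbb E[Z^2\mid |Z|>\tau]$. Let $\bar{\mathbf Y}_j=d_1^{-1/2}\sum_{i=1}^{d_1}\mathbf Y_{ij}$, and $\bar{\mathbf Y}_{J_1,j}=s_1^{-1/2}\sum_{i\in J_1}\mathbf Y_{ij}$ for $J_1\in\mathcal P_{s_1}(d_1)$. With constants $C_\tau>0$ (truncation constants, possibly different in each), let $\tau_1=\sqrt{C_\tau\log(1+d_2/s_2^2)}$ and $\tilde\tau_1=\sqrt{C_\tau\log(1+\frac{d_2}{s_2^2}\log(e\binom{d_1}{s_1}))}$, and define $$t_{\mathrm{tr},1}=\sum_{j=1}^{d_2}(\bar{\mathbf Y}_j^2-\nu_{\tau_1})\mathbf 1(|\bar{\mathbf Y}_j|>\tau_1),\qquad t_{\mathrm{mtr},1}=\max_{J_1\in\mathcal P_{s_1}(d_1)}\sum_{j=1}^{d_2}(\bar{\mathbf Y}_{J_1,j}^2-\nu_{\tilde\tau_1})\mathbf 1(|\bar{\mathbf Y}_{J_1,j}|>\tilde\tau_1),$$ $$t_{\mathrm{lin}}=\tfrac1{\sqrt{d_1d_2}}\sum_{i,j}\mathbf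 Y_{ij},\qquad t_{\mathrm{ml},1}=\max_{J_1\in\mathcal P_{s_1}(d_1)}\tfrac1{\sqrt{d_2}}\sum_{j=1}^{d_2}\bar{\mathbf Y}_{J_1,j}.$$ The statistics $t_{\mathrm{tr},2},t_{\mathrm{mtr},2},t_{\mathrm{ml},2}$ (and their truncation thresholds) are obtained by exchanging the roles of rows and columns, i.e. of $(s_1,d_1)$ and $(s_2,d_2)$. For cutoffs $h_1,h_1',h_2,h_2',h_3,h_3',h_4,h_4'>0$ define: $\Delta_a=\mathbf 1(t_{\mathrm{tr},1}>h_1)$ if $d_2/s_2^2\ge1$, and $\Delta_a=\mathbf 1(t_{\mathrm{lin}}>h_2)$ otherwise; $\Delta_b=\mathbf 1(t_{\mathrm{tr},2}>h_1')$ if $d_1/s_1^2\ge1$, and $\Delta_b=\mathbf 1(t_{\mathrm{lin}}>h_2')$ otherwise; $\Delta_c=\mathbf 1(t_{\mathrm{mtr},1}>h_3)$ if $\frac{d_2}{s_2^2}\log(e\binom{d_1}{s_1})\ge1$, and $\Delta_c=\mathbf 1(t_{\mathrm{ml},1}>h_4)$ otherwise; $\Delta_d=\mathbf 1(t_{\mathrm{mtr},2}>h_3')$ if $\frac{d_1}{s_1^2}\log(e\binom{d_2}{s_2})\ge1$, and $\Delta_d=\mathbf 1(t_{\mathrm{ml},2}>h_4')$ otherwise. Finally $\Delta^*=\Delta_a$ if $\tilde R=\phi_{12}$; $\Delta^*=\Delta_b$ if $\tilde R=\phi_{21}$; $\Delta^*=\Delta_c$ if $\tilde R=\psi_{12}+\beta_{21}$;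 $\Delta^*=\Delta_d$ if $\tilde R=\psi_{21}+\beta_{12}$ (in case of ties, the first applicable case in this list). *)

(* Defs.v *)
From HB Require Import structures.
From mathcomp Require Import all_boot all_order all_algebra.
From mathcomp Require Import all_classical all_reals all_analysis.
From mathcomp Require Import measurable_realfun.

Set Implicit Arguments.
Unset Strict Implicit.
Unset Printing Implicit Defensive.

Import Order.TTheory GRing.Theory Num.Theory.
Import numFieldNormedType.Exports.

Local Open Scope classical_set_scope.
Local Open Scope ring_scope.

Definition mx_display : measure_display -> measure_display.
Proof. exact. Qed.

(* The product sigma-algebra on m x n matrices, generated by the entries. *)
Section measurable_matrix.
Context {d : measure_display} {T : measurableType d} (m n : nat).

Definition mx_cylinders : set (set 'M[T]_(m, n)) :=
  [set B | exists i j, exists2 A : set T,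
    measurable A & B = [set M : 'M[T]_(m, n) | A (M i j)]].

Let mx_set0 : <<s mx_cylinders >> set0.
Proof. exact: sigma_algebra0. Qed.

Let mx_setC A : <<s mx_cylinders >> A -> <<s mx_cylinders >> (~` A).
Proof. exact: sigma_algebraC. Qed.

Let mx_bigcup (F : (set 'M[T]_(m, n))^nat) :
  (forall i, <<s mx_cylinders >> (F i)) -> <<s mx_cylinders >> (\bigcup_i (F i)).
Proof. exact: sigma_algebra_bigcup. Qed.

HB.instance Definition _ := @isMeasurable.Build (mx_display d)
  'M[T]_(m, n) <<s mx_cylinders >> mx_set0 mx_setC mx_bigcup.

Lemma measurable_entry i j :
  measurable_fun [set: 'M[T]_(m, n)] (fun M : 'M[T]_(m, n) => M i j).
Proof.
move=> _ A mA; rewrite setTI; apply: sub_sigma_algebra.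
by exists i, j, A.
Qed.

Lemma measurable_fun_mxP d' (T' : measurableType d') (f : T' -> 'M[T]_(m, n)) :
  (forall i j, measurable_fun [set: T'] (fun x => f x i j)) ->
  measurable_fun [set: T'] f.
Proof.
move=> mf; apply: (@measurability _ _ _ _ _ _ mx_cylinders) => //.
move=> _ [_ [i [j [A mA ->]]] <-].
exact: mf.
Qed.

End measurable_matrix.

Section model.
Context {R : realType} {d : measure_display} {T : measurableType d}
  (P : probability T R).

Definition mutually_independent (I : finType) (X : I -> T -> R) : Prop :=
  forall (J : {set I}) (A : I -> set R), (forall k, measurable (A k)) ->
    P [set w | forall k, k \in J -> A k (X k w)] =
    (\prod_(k in J) P (X k @^-1` A k))%E.

Context {d1 d2 : nat}.

Definition iid_std_normal (E : {RV P >-> 'M[R]_(d1, d2)}) : Prop :=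
  (forall i j (A : set R), measurable A ->
     P [set w | A (E w i j)] = normal_prob 0 1 A) /\
  mutually_independent (fun (k : 'I_d1 * 'I_d2) w => E w k.1 k.2).

Definition observation (E : {RV P >-> 'M[R]_(d1, d2)}) (X : 'M[R]_(d1, d2)) :
  T -> 'M[R]_(d1, d2) := fun w => X + E w.

Lemma measurable_observation E X : measurable_fun [set: T] (observation E X).
Proof.
apply: measurable_fun_mxP => i j; rewrite /observation.
under eq_fun do rewrite mxE.
apply: measurable_funD; first exact: measurable_cst.
exact: (measurableT_comp (measurable_entry i j)).
Qed.

HB.instance Definition _ E X :=
  @isMeasurableFun.Build _ _ T 'M[R]_(d1, d2) (observation E X)
    (measurable_observation E X).

(* The law P_X of Y = X + E; X = 0 gives P_0. *)
Definition law (E : {RV P >-> 'M[R]_(d1, d2)}) (X : 'M[R]_(d1, d2)) :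
  set 'M[R]_(d1, d2) -> \bar R := distribution P (observation E X).

Definition Theta (s1 s2 : nat) (mu : R) : set 'M[R]_(d1, d2) :=
  [set M | exists (S1 : {set 'I_d1}) (S2 : {set 'I_d2}),
    [/\ #|S1| = s1, #|S2| = s2,
        forall i j, i \in S1 -> j \in S2 -> mu <= M i j &
        forall i j, ~~ ((i \in S1) && (j \in S2)) -> M i j = 0]].

Definition risk (E : {RV P >-> 'M[R]_(d1, d2)}) (s1 s2 : nat)
    (Delta : {mfun 'M[R]_(d1, d2) >-> bool}) (mu : R) : \bar R :=
  (law E 0%R (Delta @^-1` [set true]) +
   ereal_sup [set law E X (Delta @^-1` [set false]) | X in Theta s1 s2 mu])%E.

End model.

Section rates.
Context {R : realType}.
Implicit Types s d : nat.

(* Natural logarithms of 'C(d, s) and of e * 'C(d, s). *)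
Definition lbin d s : R := ln ('C(d, s)%:R).

Definition lebin d s : R := ln (expR 1 * 'C(d, s)%:R).

Definition sratio s d : R := d%:R / s%:R ^+ 2.

(* Below, (s, d) is the first-index pair and (s', d') the second-index pair:
   psi_12 = psi s1 d1 s2 d2 and psi_21 = psi s2 d2 s1 d1, etc. *)
Definition psi s d s' d' : R :=
  s%:R^-1 * ln (1 + sratio s' d' * lebin d s).

Definition phi s d s' d' : R := sratio s d * ln (1 + sratio s' d').

Definition beta s d s' d' : R :=
  if 1 < sratio s d * lebin d' s' then (s%:R * s'%:R)^-1 * lbin d' s' else 0.

Definition Rtilde s1 d1 s2 d2 : R :=
  Num.min (psi s1 d1 s2 d2 + beta s2 d2 s1 d1)
    (Num.min (psi s2 d2 s1 d1 + beta s1 d1 s2 d2)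
      (Num.min (phi s1 d1 s2 d2) (phi s2 d2 s1 d1))).

End rates.

Section tests.
Context {R : realType}.

(* nu tau = E[Z^2 | |Z| > tau] for Z ~ N(0, 1). *)
Definition nu (tau : R) : R :=
  (\int[normal_prob 0 1]_(z in [set z : R | tau < `|z|]) z ^+ 2) /
  fine (normal_prob 0 1 [set z : R | tau < `|z|]).

Definition truncated (tau x : R) : R :=
  if tau < `|x| then x ^+ 2 - nu tau else 0.

Definition tau (Ctau : R) (s2 d2 : nat) : R :=
  Num.sqrt (Ctau * ln (1 + sratio s2 d2)).

Definition tau_tilde (Ctau : R) (s1 d1 s2 d2 : nat) : R :=
  Num.sqrt (Ctau * ln (1 + sratio s2 d2 * lebin d1 s1)).

(* The statistics below are those of index 1; the ones of index 2 are obtained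
   by applying them to the transposed matrix with (s1, d1) and (s2, d2)
   exchanged. *)
Context {d1 d2 : nat}.
Implicit Types Y : 'M[R]_(d1, d2).

Definition col_sum Y (j : 'I_d2) : R :=
  (Num.sqrt d1%:R)^-1 * \sum_i Y i j.

Definition sub_col_sum (s1 : nat) (J : {set 'I_d1}) Y (j : 'I_d2) : R :=
  (Num.sqrt s1%:R)^-1 * \sum_(i in J) Y i j.

Definition t_tr (Ctau : R) (s2 : nat) Y : R :=
  \sum_j truncated (tau Ctau s2 d2) (col_sum Y j).

(* For s1 <= d1 the index family is nonempty, so that the neutral element -oo
   of the maximum in the extended reals plays no role. *)
Definition t_mtr (Ctau : R) (s1 s2 : nat) Y : \bar R :=
  \big[maxe/-oo%E]_(J : {set 'I_d1} | #|J| == s1)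
    (\sum_j truncated (tau_tilde Ctau s1 d1 s2 d2) (sub_col_sum s1 J Y j))%:E.

Definition t_lin Y : R :=
  (Num.sqrt (d1%:R * d2%:R))^-1 * \sum_i \sum_j Y i j.

Definition t_ml (s1 : nat) Y : \bar R :=
  \big[maxe/-oo%E]_(J : {set 'I_d1} | #|J| == s1)
    ((Num.sqrt d2%:R)^-1 * \sum_j sub_col_sum s1 J Y j)%:E.

(* Delta_b is Delta_a on the transposed matrix, with the pairs (s1, d1) and
   (s2, d2) exchanged; likewise Delta_d and Delta_c below. *)
Definition Delta_a (Ctau h h' : R) (s2 : nat) Y : bool :=
  if 1 <= sratio s2 d2 :> R then h < t_tr Ctau s2 Y else h' < t_lin Y.

Definition Delta_c (Ctau h h' : R) (s1 s2 : nat) Y : bool :=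
  if 1 <= sratio s2 d2 * lebin d1 s1 :> R
  then (h%:E < t_mtr Ctau s1 s2 Y)%E
  else (h'%:E < t_ml s1 Y)%E.

Lemma measurable_truncated (t : R) : measurable_fun [set: R] (truncated t).
Proof.
rewrite /truncated; apply: measurable_fun_ifT => //.
- exact: measurable_fun_ltr.
- exact: measurable_funB.
Qed.

Lemma measurable_col_sum j :
  measurable_fun [set: 'M[R]_(d1, d2)] (fun Y => col_sum Y j).
Proof.
apply: measurable_funM => //; apply: measurable_sum => i.
exact: measurable_entry.
Qed.

Lemma measurable_sub_col_sum s1 J j :
  measurable_fun [set: 'M[R]_(d1, d2)] (fun Y => sub_col_sum s1 J Y j).
Proof.
apply: measurable_funM => //.
under eq_fun do rewrite -big_filter.
apply: measurable_sum => i; exact: measurable_entry.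
Qed.

Lemma measurable_bigmaxe d (T : measurableType d) (I : Type) (r : seq I)
    (Q : pred I) (f : I -> T -> \bar R) :
  (forall i, measurable_fun [set: T] (f i)) ->
  measurable_fun [set: T] (fun x => \big[maxe/-oo%E]_(i <- r | Q i) f i x).
Proof.
move=> mf; elim: r => [|i r ih].
  by under eq_fun do rewrite big_nil; exact: measurable_cst.
under eq_fun do rewrite big_cons.
by case: (Q i) => //; exact: measurable_maxe.
Qed.

Lemma measurable_Delta_a Ctau h h' s2 :
  measurable_fun [set: 'M[R]_(d1, d2)] (Delta_a Ctau h h' s2).
Proof.
rewrite /Delta_a; case: (1 <= _); apply: measurable_fun_ltr => //.
  apply: measurable_sum => j.
  apply: measurableT_comp; first exact: measurable_truncated.
  exact: measurable_col_sum.
apply: measurable_funM => //; apply: measurable_sum => i.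
by apply: measurable_sum => j; exact: measurable_entry.
Qed.

Lemma measurable_Delta_c Ctau h h' s1 s2 :
  measurable_fun [set: 'M[R]_(d1, d2)] (Delta_c Ctau h h' s1 s2).
Proof.
rewrite /Delta_c; case: (1 <= _); apply: measurable_fun_lte => //;
  apply: measurable_bigmaxe => J; apply/measurable_EFinP.
  apply: measurable_sum => j.
  apply: measurableT_comp; first exact: measurable_truncated.
  exact: measurable_sub_col_sum.
apply: measurable_funM => //; apply: measurable_sum => j.
exact: measurable_sub_col_sum.
Qed.

Lemma measurable_trmx :
  measurable_fun [set: 'M[R]_(d1, d2)] (@trmx R d1 d2).
Proof.
apply: measurable_fun_mxP => i j; under eq_fun do rewrite mxE.
exact: measurable_entry.
Qed.

End tests.

Section Delta_star.
Context {R : realType} {d1 d2 : nat}.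

(* Ties are resolved in favour of the first applicable case.
   Ct1, Ct2, Cm1, Cm2 are the truncation constants of t_tr1, t_tr2, t_mtr1 and
   t_mtr2. When the first three tests of the cascade fail, Rtilde is the
   remaining term psi_21 + beta_12. *)
Definition Delta_star (Ct1 Ct2 Cm1 Cm2 h1 h1' h2 h2' h3 h3' h4 h4' : R)
    (s1 s2 : nat) (Y : 'M[R]_(d1, d2)) : bool :=
  if Rtilde s1 d1 s2 d2 == phi s1 d1 s2 d2 :> R then
    Delta_a Ct1 h1 h2 s2 Y
  else if Rtilde s1 d1 s2 d2 == phi s2 d2 s1 d1 :> R then
    Delta_a Ct2 h1' h2' s1 Y^T
  else if Rtilde s1 d1 s2 d2 == psi s1 d1 s2 d2 + beta s2 d2 s1 d1 :> R then
    Delta_c Cm1 h3 h4 s1 s2 Y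
  else
    Delta_c Cm2 h3' h4' s2 s1 Y^T.

Lemma measurable_Delta_star Ct1 Ct2 Cm1 Cm2 h1 h1' h2 h2' h3 h3' h4 h4' s1 s2 :
  measurable_fun [set: 'M[R]_(d1, d2)]
    (Delta_star Ct1 Ct2 Cm1 Cm2 h1 h1' h2 h2' h3 h3' h4 h4' s1 s2).
Proof.
rewrite /Delta_star; case: (_ == _); first exact: measurable_Delta_a.
case: (_ == _).
  apply: measurableT_comp; last exact: measurable_trmx.
  exact: measurable_Delta_a.
case: (_ == _); first exact: measurable_Delta_c.
apply: measurableT_comp; last exact: measurable_trmx.
exact: measurable_Delta_c.
Qed.

HB.instance Definition _ Ct1 Ct2 Cm1 Cm2 h1 h1' h2 h2' h3 h3' h4 h4' s1 s2 :=
  @isMeasurableFun.Build _ _ 'M[R]_(d1, d2) bool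
    (Delta_star Ct1 Ct2 Cm1 Cm2 h1 h1' h2 h2' h3 h3' h4 h4' s1 s2)
    (measurable_Delta_star Ct1 Ct2 Cm1 Cm2 h1 h1' h2 h2' h3 h3' h4 h4' s1 s2).

End Delta_star.

(* Main.v *)
(* By Markov's inequality for exponentials, everything reduces to one product
   formula: for the normalized sums Z_j of the noise over a fixed set J of rows
   and the columns j, E prod_j g_j(Z_j) = prod_j E g_j(Z) with Z ~ N(0, 1).
   - Null, truncated statistics: nu_tau makes each truncated term centred, and
     the truncation at tau^2 = 8 log(1 + x), x = (d_2 / s_2^2) l, gives the sum
     a log-Laplace transform at most K lambda^2 s_2^2 / l; with
     l = log(e binom(d_1, s_1)) and lambda ~ min(1, l / s_2), the tail beats
     the union bound over the binom(d_1, s_1) row sets. The non-scanning tests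
     are the case l = 1 with J the set of all rows.
   - Alternative: (y^2 - nu_tau) 1(|y| > tau) >= y^2 - nu_tau - tau^2, so one
     exponential moment with lambda ~ 1 / s_2 controls signal and noise at once,
     for J the support rows.
   - Delta^* only needs mu^2 >= C Rtilde, and Rtilde <= 4 R: if
     log(e binom(d_2, s_2)) >= s_1 then beta_21 <~ psi_21, symmetrically for
     beta_12, and if log(e binom(d_1, s_1)) < s_2 then beta_21 <~ psi_12. *)
From HB Require Import structures.
Require Import Defs.
From mathcomp Require Import all_boot all_order all_algebra.
From mathcomp Require Import all_classical all_reals all_analysis.
From mathcomp Require Import measurable_realfun ring lra.

Set Implicit Arguments.
Unset Strict Implicit.
Unset Printing Implicit Defensive.

Import Order.TTheory GRing.Theory Num.Theory.
Import numFieldNormedType.Exports.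
Import HBNNSimple.

Local Open Scope classical_set_scope.
Local Open Scope ring_scope.

(** * Measures with a density, images of measures *)

(** The product formula is derived from the bare definition of mutual independence by absorbing one
    variable at a time into a growing random vector. Each absorption extends an identity on
    rectangles to all measurable sets, and the convolution of Gaussian densities keeps the law of
    the partial sum explicit.

    The constant 8 in the truncation level comes from the Laplace transform of one truncated square.
    Every integrand is dominated by a multiple of exp(z^2/4), and on |z| > t half of that exponent
    can be traded for exp(-t^2/8), which is 1/(1 + x) when t^2 = 8 log(1 + x); the d_2 columns
    together then weigh d_2/(1 + x) <= s_2^2/l.

    Each of the two errors is brought below exp(-A) = eta/2. Under the null each row set needs the
    exponent (1 + A) l to survive the union. Under the alternative a single row set is examined, so
    the exponent A is enough, which is why a smaller lambda can be used there.

    All estimates are proved for the tests of index 1 and transferred to index 2 by transposing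
    noise and signal. *)

Section density.
Local Open Scope ereal_scope.
Context d (T : measurableType d) (R : realType).
Variables (mu nu : {measure set T -> \bar R}) (p : T -> R).
Hypothesis mp : measurable_fun setT p.
Hypothesis p0 : forall x, (0 <= p x)%R.
Hypothesis nuE : forall A, measurable A -> nu A = \int[mu]_(x in A) (p x)%:E.

Let density_indic A : measurable A ->
  \int[nu]_x (\1_A x)%:E = \int[mu]_x ((\1_A x)%:E * (p x)%:E).
Proof.
move=> mA; rewrite integral_indic// setIT nuE// integral_mkcond.
apply: eq_integral => x _; rewrite patchE indicE.
by case: (x \in A); rewrite ?mul1e ?mul0e.
Qed.

Let density_nnsfun (f : {nnsfun T >-> R}) :
  \int[nu]_x (f x)%:E = \int[mu]_x ((f x)%:E * (p x)%:E).
Proof.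
have mpE : measurable_fun setT (EFin \o p) by exact/measurable_EFinP.
under [LHS]eq_integral do rewrite fimfunE -fsumEFin//.
rewrite [LHS]ge0_integral_fsum//; last 2 first.
- by move=> r; exact/measurable_EFinP/measurableT_comp.
- by move=> n x _; rewrite EFinM nnfun_muleindic_ge0.
under [RHS]eq_integral.
  move=> x _; rewrite fimfunE -fsumEFin// ge0_mule_fsuml; last first.
    by move=> r; rewrite EFinM nnfun_muleindic_ge0.
  over.
rewrite [RHS]ge0_integral_fsum//; last 2 first.
- move=> r; apply: emeasurable_funM => //.
  by apply/measurable_EFinP; exact: measurableT_comp.
- by move=> n x _; rewrite mule_ge0 ?lee_fin// -lee_fin EFinM nnfun_muleindic_ge0.
apply: eq_fsbigr => r rf.
have r0 : (0 <= r)%R by move: rf; rewrite inE => -[x _ <-].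
have mr : measurable (f @^-1` [set r]) by exact: measurable_sfunP.
under [LHS]eq_integral do rewrite EFinM.
rewrite ge0_integralZl ?lee_fin//; last first.
  by apply/measurable_EFinP; exact: measurable_indic.
rewrite density_indic// -ge0_integralZl//.
- by apply: eq_integral => x _; rewrite EFinM muleA.
- apply: emeasurable_funM => //; apply/measurable_EFinP; exact: measurable_indic.
- by move=> x _; rewrite mule_ge0// lee_fin.
Qed.

(** The usual ladder: indicators, nonnegative simple functions, then increasing limits, with
    monotone convergence applied on both sides. *)
Lemma ge0_integral_density (f : T -> \bar R) : measurable_fun setT f ->
  (forall x, 0 <= f x) -> \int[nu]_x f x = \int[mu]_x (f x * (p x)%:E).
Proof.
move=> mf f0; pose f_ := nnsfun_approx measurableT mf.
have fcvg x : (f_ n x)%:E @[n --> \oo] --> f x by exact: cvg_nnsfun_approx.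
have fnd x : {homo (fun n => (f_ n x)%:E) : m n / (m <= n)%N >-> m <= n}.
  by move=> m n mn; rewrite lee_fin; exact/lefP/nd_nnsfun_approx.
have mfn n : measurable_fun setT (fun x => (f_ n x)%:E) by exact/measurable_EFinP.
have mpE : measurable_fun setT (EFin \o p) by exact/measurable_EFinP.
rewrite (eq_integral (fun x => limn (fun n => (f_ n x)%:E))); last first.
  by move=> x _; apply/esym/cvg_lim.
rewrite monotone_convergence//; last by move=> n x _; rewrite lee_fin.
rewrite [RHS](eq_integral (fun x => limn (fun n => (f_ n x)%:E * (p x)%:E))).
  rewrite monotone_convergence//.
  - by apply: congr_lim; apply/funext => n; exact: density_nnsfun.
  - by move=> n; exact: emeasurable_funM.
  - by move=> n x _; rewrite mule_ge0// lee_fin.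
  - by move=> x _ m n mn; rewrite lee_wpmul2r ?lee_fin//; exact: fnd.
by move=> x _; apply/esym/cvg_lim => //; exact: cvgeZr.
Qed.
End density.

Section image_measure.
Local Open Scope ereal_scope.
Context d d' (T : measurableType d) (T' : measurableType d') (R : realType).
Variables (mu : {measure set T -> \bar R}) (F : set T) (f : T -> T').
Hypotheses (mF : measurable F) (mf : measurable_fun setT f).

(* Restricting mu to F lets the product-measure arguments run on an event. *)
Definition image_measure of measurable F & measurable_fun setT f :=
  fun A : set T' => mu (F `&` f @^-1` A).

Local Notation nu := (image_measure mF mf).

Let mpre A : measurable A -> measurable (F `&` f @^-1` A).
Proof. by move=> mA; apply: measurableI => //; rewrite -[X in measurable X]setTI; exact: mf. Qed.

Let nu0 : nu set0 = 0.
Proof. by rewrite /image_measure preimage_set0 setI0 measure0. Qed.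

Let nu_ge0 A : 0 <= nu A. Proof. exact: measure_ge0. Qed.

Let nu_sigma_additive : semi_sigma_additive nu.
Proof.
move=> A mA tA mUA; rewrite /image_measure preimage_bigcup setI_bigcupr.
apply: measure_semi_sigma_additive.
- by move=> n; exact: mpre.
- apply: trivIset_setIl; apply/trivIsetP => /= i j _ _ ij.
  rewrite -preimage_setI.
  by move/trivIsetP : tA => /(_ _ _ _ _ ij) ->//; rewrite preimage_set0.
- by rewrite -setI_bigcupr -preimage_bigcup; exact: mpre.
Qed.

HB.instance Definition _ := isMeasure.Build _ _ _ nu nu0 nu_ge0 nu_sigma_additive.

End image_measure.

Lemma ge0_integral_image d d' (T : measurableType d) (T' : measurableType d')
    (R : realType) (mu : {measure set T -> \bar R}) (f : T -> T')
    (mf : measurable_fun setT f) (g : T' -> \bar R) :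
  measurable_fun setT g -> (forall x, 0 <= g x)%E ->
  (\int[image_measure mu measurableT mf]_x g x = \int[mu]_x g (f x))%E.
Proof.
move=> mg g0.
transitivity (\int[pushforward mu f]_x g x)%E; last first.
  by rewrite (ge0_integral_pushforward mf) ?preimage_setT.
by apply: eq_measure_integral => A mA _; rewrite /= /image_measure setTI.
Qed.

Section rectangles.
Local Open Scope ereal_scope.
Context d1 d2 (T1 : measurableType d1) (T2 : measurableType d2) (R : realType).
Variables m m' : {measure set (T1 * T2) -> \bar R}.

(** Rectangles form a pi-system generating the product sigma-algebra. The whole space is itself a
    rectangle of finite mass, so the constant sequence serves as the exhausting cover. *)
Lemma measure_eq_rectangles : m setT < +oo ->
  (forall A B, measurable A -> measurable B -> m (A `*` B) = m' (A `*` B)) ->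
  forall W, measurable W -> m W = m' W.
Proof.
move=> mT mm' W mW.
pose C := [set A `*` B | A in @measurable _ T1 & B in @measurable _ T2].
apply: (measure_unique C (fun _ => setT)) => //.
- by rewrite measurable_prod_measurableType.
- move=> _ _ [A mA [B mB <-]] [A' mA' [B' mB' <-]].
  exists (A `&` A'); first exact: measurableI.
  by exists (B `&` B'); [exact: measurableI|rewrite setXI].
- by move=> _; exists setT => //; exists setT => //; rewrite setXTT.
- by rewrite bigcup_const//; exists 0%N.
- by move=> _ [A mA [B mB <-]]; exact: mm'.
Qed.

End rectangles.

(** * Affine substitutions in Lebesgue integrals *)

Section affine.
Local Open Scope ereal_scope.
Context (R : realType).
Notation leb := (@lebesgue_measure R).
Variables (a b : R).
Hypothesis a0 : (0 < a)%R.
Let f (x : R) : measurableTypeR R := (a * x + b)%R.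
Let mf : measurable_fun [set: measurableTypeR R] f.
Proof. by apply: measurable_funD => //; exact: measurable_funM. Qed.
Let c : {nonneg R} := NngNum (ltW a0).
Let m : {measure set (measurableTypeR R) -> \bar R} :=
  mscale c (image_measure leb measurableT mf).

(** The image of Lebesgue measure under x -> a x + b divides lengths by a; the factor a restores
    them, and half-open intervals determine the measure. *)
Let lebE A : measurable A -> leb A = m A.
Proof.
apply: lebesgue_measure_unique => _ [[x y]] _ <- /=.
rewrite /m /mscale /= /image_measure setTI.
have -> : f @^-1` `]x, y] = `]((x - b) / a)%R, ((y - b) / a)%R]%classic.
  apply/seteqP; split => z /=; rewrite !in_itv/= /f.
    by rewrite ltr_pdivrMr// ler_pdivlMr// ltrBlDr lerBrDr mulrC.
  by rewrite ltr_pdivrMr// ler_pdivlMr// ltrBlDr lerBrDr mulrC.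
rewrite !lebesgue_measure_itv/= !lte_fin ltr_pM2r ?invr_gt0// ltrD2r.
case: ifPn => _; rewrite ?mule0// -!EFinD -EFinM; congr EFin.
by field; rewrite gt_eqF.
Qed.

Lemma ge0_integral_affine (g : R -> \bar R) : measurable_fun setT g ->
  (forall x, 0 <= g x) ->
  \int[leb]_x g x = a%:E * \int[leb]_x g (a * x + b)%R.
Proof.
move=> mg g0; rewrite (eq_measure_integral m) => [|A mA _]; last exact: lebE.
rewrite ge0_integral_mscale//; congr (_ * _).
exact: ge0_integral_image.
Qed.
End affine.

(** * Gaussian integrals *)

Section normal_integrals.
Context (R : realType).
Notation leb := (@lebesgue_measure R).
Implicit Types (s l u x : R).

Lemma ge0_integral_normal m s (g : R -> \bar R) : measurable_fun setT g ->
  (forall x, 0 <= g x)%E ->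
  (\int[normal_prob m s]_x g x = \int[leb]_x (g x * (normal_pdf m s x)%:E))%E.
Proof.
move=> mg g0; apply: ge0_integral_density => //.
- exact: measurable_normal_pdf.
- exact: normal_pdf_ge0.
Qed.

Lemma normal_pdfE1 m s x : 0 < s ->
  normal_pdf m s x = (Num.sqrt (pi *+ 2))^-1 / s * expR (- (x - m) ^+ 2 / (s ^+ 2 *+ 2)).
Proof.
move=> s0; rewrite normal_pdfE ?gt_eqF// /normal_peak /normal_fun -mulrnAr.
by rewrite sqrtrM ?sqr_ge0// sqrtr_sqr gtr0_norm// invfM [s^-1 * _]mulrC.
Qed.

(** Completing the square in x: the joint density of (X, X + Y) is the density of the sum times the
    conditional density of X given the sum. Integrating out x leaves the first factor. *)
Lemma normal_pdf_conv s x u : 0 < s ->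
  let t := Num.sqrt (s ^+ 2 + 1) in
  normal_pdf 0 s x * normal_pdf 0 1 (u - x) =
  normal_pdf 0 t u * normal_pdf (u * s ^+ 2 / t ^+ 2) (s / t) x.
Proof.
move=> s0 t; have s21 : 0 < s ^+ 2 + 1 by rewrite addr_gt0// exprn_gt0.
have t0 : 0 < t by rewrite sqrtr_gt0.
have t2 : t ^+ 2 = s ^+ 2 + 1 by rewrite sqr_sqrtr// ltW.
rewrite !normal_pdfE1 ?divr_gt0//.
set c := (Num.sqrt _)^-1; rewrite mulrACA [RHS]mulrACA -!expRD.
congr (_ * expR _); first by field; rewrite !gt_eqF.
rewrite !expr_div_n t2; field.
by rewrite !gt_eqF.
Qed.

(** Substitution u = x + y, Tonelli, then [normal_pdf_conv]. The second summand is standard because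
    [indep_rest_sum] adds the variables of a block one by one. *)
Lemma integral_normal_conv s (g : R -> \bar R) : 0 < s ->
  measurable_fun setT g -> (forall x, 0 <= g x)%E ->
  (\int[normal_prob 0 s]_x \int[normal_prob 0 1]_y g (x + y)%R =
   \int[normal_prob 0 (Num.sqrt (s ^+ 2 + 1))]_x g x)%E.
Proof.
move=> s0 mg g0.
have mgp m r : measurable_fun setT (fun z : R => (normal_pdf m r z)%:E).
  by apply/measurable_EFinP; apply: measurable_normal_pdf.
pose F (z : R * R) := ((normal_pdf 0 s z.1)%:E * (g z.2 * (normal_pdf 0 1 (z.2 - z.1))%:E))%E.
have mF : measurable_fun setT F.
  apply: emeasurable_funM; first exact: (measurableT_comp (mgp 0 s)).
  apply: emeasurable_funM; first exact: (measurableT_comp mg).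
  apply: (measurableT_comp (mgp 0 1)); by apply: measurable_funB.
have F0 z : (0 <= F z)%E by rewrite !mule_ge0// lee_fin normal_pdf_ge0.
pose G (z : R * R) := (g z.2 * (normal_pdf 0 1 (z.2 - z.1))%:E)%E.
have mG : measurable_fun setT G.
  apply: emeasurable_funM; first exact: (measurableT_comp mg).
  by apply: (measurableT_comp (mgp 0 1)); apply: measurable_funB.
have G0 z : (0 <= G z)%E by rewrite mule_ge0// lee_fin normal_pdf_ge0.
have mGx x : measurable_fun setT (fun u => G (x, u)).
  by apply: (measurableT_comp mG); exact: measurable_pair1.
have inner x : (\int[normal_prob 0 1]_y g (x + y)%R = \int[leb]_u G (x, u))%E.
  rewrite ge0_integral_normal; last 2 first.
  - by apply: (measurableT_comp mg); apply: measurable_funD.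
  - by move=> y; exact: g0.
  rewrite [RHS](@ge0_integral_affine _ 1 x) ?ltr01//.
  rewrite mul1e; apply: eq_integral => y _.
  by rewrite /G/= mul1r addrK addrC.
transitivity (\int[normal_prob 0 s]_x \int[leb]_u G (x, u))%E.
  by apply: eq_integral => x _; exact: inner.
have innerF x : ((\int[leb]_u G (x, u)) * (normal_pdf 0 s x)%:E =
    \int[leb]_u F (x, u))%E.
  rewrite muleC -ge0_integralZl ?lee_fin ?normal_pdf_ge0//; exact: mGx.
rewrite ge0_integral_normal; last 2 first.
- exact: measurable_fun_fubini_tonelli_F.
- by move=> x; apply: integral_ge0 => u _; exact: G0.
transitivity (\int[leb]_x \int[leb]_u F (x, u))%E.
  by apply: eq_integral => x _; exact: innerF.
transitivity (\int[leb]_u \int[leb]_x F (x, u))%E.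
  exact: (@fubini_tonelli _ _ _ _ R leb leb F mF F0).
rewrite [RHS](ge0_integral_normal _ _ mg g0).
apply: eq_integral => u _.
under eq_integral.
  move=> x _; rewrite /F/= muleCA -EFinM normal_pdf_conv// EFinM muleA.
  over.
rewrite ge0_integralZl//; first by rewrite integral_normal_pdf mule1.
- exact: mgp.
- by move=> x _; rewrite lee_fin normal_pdf_ge0.
- by rewrite mule_ge0// lee_fin normal_pdf_ge0.
Qed.

Lemma integral_normal_scale s (g : R -> \bar R) : 0 < s ->
  measurable_fun setT g -> (forall x, 0 <= g x)%E ->
  (\int[normal_prob 0 s]_x g (s^-1 * x)%R = \int[normal_prob 0 1]_x g x)%E.
Proof.
move=> s0 mg g0.
have mgs : measurable_fun setT (fun x => g (s^-1 * x)%R).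
  by apply: (measurableT_comp mg); exact: measurable_funM.
have mp m r : measurable_fun setT (fun z : R => (normal_pdf m r z)%:E).
  by apply/measurable_EFinP; apply: measurable_normal_pdf.
rewrite (ge0_integral_normal 0 s mgs (fun x => g0 _)) (ge0_integral_normal 0 1 mg g0).
rewrite (@ge0_integral_affine _ s 0 s0); last 2 first.
- exact: emeasurable_funM.
- by move=> x; rewrite mule_ge0// lee_fin normal_pdf_ge0.
rewrite -ge0_integralZl ?lee_fin ?(ltW s0)//.
- apply: eq_integral => x _; rewrite addr0 mulKf ?gt_eqF// muleCA -EFinM.
  congr (_ * _%:E)%E; rewrite !normal_pdfE1//.
  rewrite mulrA; congr (_ * expR _); first by field; rewrite ?gt_eqF// sqrtr_gt0 mulrn_wgt0// pi_gt0.
  by field; rewrite gt_eqF.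
- apply: emeasurable_funM.
    by apply: (measurableT_comp mgs); apply: measurable_funD.
  by apply: (measurableT_comp (mp 0 s)); apply: measurable_funD.
- by move=> x _; rewrite mule_ge0// lee_fin normal_pdf_ge0.
Qed.

(** Exponential tilting: g turns the standard density into c times another normal density, whose
    total mass is 1. The two Gaussian integrals that follow are instances. *)
Lemma integral_normal_tilt (g : R -> R) c m s : measurable_fun setT g ->
  0 <= c -> (forall z, 0 <= g z) ->
  (forall z, g z * normal_pdf 0 1 z = c * normal_pdf m s z) ->
  (\int[normal_prob 0 1]_z (g z)%:E = c%:E)%E.
Proof.
move=> mg c0 g0 gE; rewrite ge0_integral_normal; last 2 first.
- exact/measurable_EFinP.
- by move=> z; rewrite lee_fin.
transitivity (\int[leb]_z (c%:E * (normal_pdf m s z)%:E))%E.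
  by apply: eq_integral => z _; rewrite -!EFinM gE.
rewrite ge0_integralZl ?lee_fin//.
- by rewrite integral_normal_pdf mule1.
- by apply/measurable_EFinP; exact: measurable_normal_pdf.
- by move=> z _; rewrite lee_fin normal_pdf_ge0.
Qed.

Lemma normal_mgf l :
  (\int[normal_prob 0 1]_z (expR (l * z))%:E = (expR (l ^+ 2 / 2))%:E)%E.
Proof.
apply: (@integral_normal_tilt _ _ l 1); rewrite ?expR_ge0 //.
- by apply: measurableT_comp => //; exact: measurable_funM.
move=> z; rewrite !normal_pdfE1// mulrCA [in RHS]mulrCA -!expRD.
by congr (_ * expR _); field.
Qed.

Lemma normal_exp_sqr :
  (\int[normal_prob 0 1]_z (expR (z ^+ 2 / 4 : R))%:E = (Num.sqrt 2)%:E)%E.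
Proof.
have s2 : 0 < Num.sqrt 2 :> R by rewrite sqrtr_gt0.
apply: (@integral_normal_tilt _ _ 0 (Num.sqrt 2)); rewrite ?sqrtr_ge0//.
- apply: measurableT_comp => //.
  by apply: measurable_funM => //; exact: measurable_funX.
move=> z; rewrite !normal_pdfE1// mulrCA -!expRD !mulrA.
rewrite sqr_sqrtr//; congr (_ * expR _); last by field.
by set c := (Num.sqrt (pi *+ 2))^-1; field; rewrite gt_eqF.
Qed.

End normal_integrals.

(** * Independent blocks of Gaussian variables *)

Section independence.
Local Open Scope ereal_scope.
Context (R : realType) d (T : measurableType d) (P : probability T R).
Context (K : finType) (X : K -> T -> R).
Hypothesis mX : forall k, measurable_fun setT (X k).
Notation gam := (@normal_prob R 0%R 1%R).

Let sel (D : {set K}) (B : K -> set R) : set T :=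
  [set w | forall k, k \in D -> B k (X k w)].

Let msel D B : (forall k, measurable (B k)) -> measurable (sel D B).
Proof.
move=> mB; rewrite [X in measurable X](_ : _ =
    \bigcap_(k in [set k | k \in D]) (X k @^-1` B k)).
  apply: fin_bigcap_measurable => // k _.
  by rewrite -[X in measurable X]setTI; exact: mX.
by apply/seteqP; split.
Qed.

(* U is independent of the family (X k), k in D, whose members are N(0, 1) and
   mutually independent. *)
Definition indep_rest dA (A : measurableType dA) (U : T -> A) (D : {set K}) :=
  forall (S : set A) (B : K -> set R), measurable S -> (forall k, measurable (B k)) ->
  P (sel D B `&` U @^-1` S) = P (U @^-1` S) * \prod_(k in D) gam (B k).

Definition indep_law dA (A : measurableType dA) (U : T -> A) (V : T -> R)
    (nu : set R -> \bar R) :=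
  forall (S : set A) (B : set R), measurable S -> measurable B ->
  P (U @^-1` S `&` V @^-1` B) = P (U @^-1` S) * nu B.

Section with_U.
Context dA (A : measurableType dA) (U : T -> A).
Hypothesis mU : measurable_fun setT U.

Lemma indep_rest_comp dA' (A' : measurableType dA') (f : A -> A') D :
  measurable_fun setT f -> indep_rest U D -> indep_rest (f \o U) D.
Proof.
move=> mf iU S B mS mB; rewrite comp_preimage; apply: iU => //.
by rewrite -[X in measurable X]setTI; exact: mf.
Qed.

Lemma indep_restW (D D' : {set K}) : D' \subset D -> indep_rest U D -> indep_rest U D'.
Proof.
move=> /fintype.subsetP DD' iU S B mS mB.
pose B' k := if k \in D' then B k else setT.
have mB' k : measurable (B' k) by rewrite /B'; case: ifP.
have := iU S B' mS mB'.
rewrite (_ : sel D B' = sel D' B); last first.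
  apply/seteqP; split => w /= H k kD.
    by have := H k (DD' _ kD); rewrite /B' kD.
  by rewrite /B'; case: ifPn => // /H.
move=> ->; congr (_ * _); rewrite (big_setID D')/= (finset.setIidPr (introT fintype.subsetP DD')).
rewrite [X in _ * X]big1 ?mule1; last first.
  by move=> k; rewrite inE /B' => /andP[/negbTE -> _]; exact: probability_setT.
by apply: eq_bigr => k; rewrite /B' => ->.
Qed.

Let pair_rect (D : {set K}) k : k \in D -> indep_rest U D ->
  forall S C B, measurable S -> measurable C -> (forall k, measurable (B k)) ->
  P (sel (D :\ k) B `&` (fun w => (U w, X k w)) @^-1` (S `*` C)) =
  P (U @^-1` S) * (gam C * \prod_(l in D :\ k) gam (B l)).
Proof.
move=> kD iU S C B mS mC mB.
pose B' l := if l == k then C else B l.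
have mB' l : measurable (B' l) by rewrite /B'; case: ifP.
have := iU S B' mS mB'.
have B'k : B' k = C by rewrite /B' eqxx.
rewrite (big_setD1 k)//= B'k => H.
rewrite (_ : _ `&` _ = sel D B' `&` U @^-1` S).
  rewrite H; congr (_ * (_ * _)); apply: eq_bigr => l.
  by rewrite !inE /B' => /andP[/negbTE ->].
apply/seteqP; split => w /= [].
  move=> Hs [SU Ck]; split => // l lD; rewrite /B'; case: eqP => [->//|/eqP lk].
  by apply: Hs; rewrite !inE lk.
move=> Hs SU; split; last split => //.
  move=> l; rewrite !inE => /andP[lk lD].
  by have := Hs l lD; rewrite /B' (negbTE lk).
by have := Hs k kD; rewrite /B' eqxx.
Qed.

Let mUX k : measurable_fun setT (fun w => (U w, X k w)).
Proof. exact: measurable_fun_pair. Qed.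

Lemma indep_law_absorb (D : {set K}) k : k \in D -> indep_rest U D -> indep_law U (X k) gam.
Proof.
move=> kD iU S C mS mC.
have := @pair_rect D k kD iU S C (fun _ => setT) mS mC (fun _ => measurableT).
rewrite [X in _ * (_ * X)]big1 ?mule1; last by move=> *; exact: probability_setT.
move=> <-; congr (P _).
by apply/seteqP; split => w /= []; [split|].
Qed.

(** In W both sides are finite measures, the left one being an image measure restricted to the event
    [sel], so rectangles suffice and [pair_rect] treats them. *)
Lemma indep_rest_absorb (D : {set K}) k : k \in D -> indep_rest U D ->
  indep_rest (fun w => (U w, X k w)) (D :\ k).
Proof.
move=> kD iU W B mW mB.
pose c : {nonneg R} := NngNum (fine_ge0 (prode_ge0 (index_enum K)
  (fun l (_ : l \in D :\ k) => measure_ge0 gam (B l)))).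
have cE : c%:num%:E = \prod_(l in D :\ k) gam (B l).
  by rewrite fineK//; apply: prode_fin_num => l _; exact: (@fin_num_measure _ _ _ (normal_prob 0 1) (B l) (mB l)).
have ms : measurable (sel (D :\ k) B) by exact: msel.
rewrite -cE muleC.
transitivity (image_measure P ms (mUX k) W); first by [].
transitivity (mscale c (image_measure P measurableT (mUX k)) W); last first.
  by rewrite /mscale/= /image_measure setTI.
apply: measure_eq_rectangles => //.
- rewrite /= /image_measure.
  apply: le_lt_trans (ltry 1%R); apply: probability_le1.
  by apply: measurableI => //; rewrite preimage_setT.
move=> S C mS mC.
transitivity (c%:num%:E * P ((fun w => (U w, X k w)) @^-1` (S `*` C))); last first.
  by rewrite /= /mscale /image_measure /= [X in _ = _ * P X]setTI.
rewrite cE /= /image_measure pair_rect//; have := @indep_law_absorb D k kD iU S C mS mC.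
by move=> H; rewrite muleA -H muleC; congr (_ * P _); apply/seteqP; split.
Qed.

Let U_mfun : {mfun T >-> A} := HB.pack U (isMeasurableFun.Build _ _ _ _ U mU).

(** Independence makes the joint law of (U, V) a product measure, so that Tonelli integrates V out
    first. *)
Lemma indep_law_integral (V : T -> R) (nu : probability (measurableTypeR R) R)
    (g : A * measurableTypeR R -> \bar R) :
  measurable_fun setT V -> indep_law U V nu ->
  measurable_fun setT g -> (forall z, 0 <= g z) ->
  \int[P]_w g (U w, V w) = \int[P]_w \int[nu]_v g (U w, v).
Proof.
move=> mV iUV mg g0.
have mUV : measurable_fun setT (fun w => (U w, V w) : A * measurableTypeR R).
  exact: measurable_fun_pair.
rewrite -(ge0_integral_image P mUV mg g0).
transitivity (\int[distribution P U_mfun \x nu]_z g z).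
  apply: eq_measure_integral => W mW _; apply: measure_eq_rectangles => //.
    rewrite /= /image_measure.
    apply: le_lt_trans (ltry 1%R); apply: probability_le1.
    by apply: measurableI => //; rewrite preimage_setT.
  move=> S B mS mB; rewrite [RHS]product_measure1E//= /image_measure setTI.
  by rewrite -iUV.
rewrite fubini_tonelli1// ge0_integral_distribution//.
  exact: measurable_fun_fubini_tonelli_F.
by move=> u; apply: integral_ge0.
Qed.

End with_U.

(** The two conclusions feed each other in the induction: the first makes the next variable
    independent of (U, partial sum), and the second supplies the law to be convolved with it. The
    list is nonempty so that the standard deviation is positive. *)
Lemma indep_rest_sum dA (A : measurableType dA) (U : T -> A) (D : {set K}) k c :
  measurable_fun setT U -> uniq (k :: c) -> {subset k :: c <= D} -> indep_rest U D ->
  let S w := (\sum_(l <- k :: c) X l w)%R in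
  indep_rest (fun w => (U w, S w)) [set l in D | l \notin k :: c] /\
  indep_law U S (normal_prob 0 (Num.sqrt (size (k :: c))%:R)).
Proof.
move=> mU; elim: c k => [k _ kD iU S|k' c ih k /andP[kc uc] kcD iU S].
  have SE : S = X k by apply/funext => w; rewrite /S big_seq1.
  have kD' : k \in D by rewrite kD// inE.
  rewrite SE /= sqrtr1; split; last exact: indep_law_absorb kD' iU.
  apply: (@indep_restW _ _ _ (D :\ k)%SET); last exact: indep_rest_absorb.
  by apply/fintype.subsetP => l; rewrite !inE andbC.
have k'D : {subset k' :: c <= D} by move=> l lc; apply: kcD; rewrite inE lc orbT.
have [i1 l1] := ih k' uc k'D iU.
set S' := fun w => (\sum_(l <- k' :: c) X l w)%R in i1 l1.
set D1 := [set l in D | l \notin k' :: c]%SET in i1.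
have kD1 : k \in D1 by rewrite !inE kcD ?mem_head.
have mS' : measurable_fun setT S' by apply: measurable_sum.
have mUS' : measurable_fun setT (fun w => (U w, S' w)).
  exact: measurable_fun_pair.
have SE : S = (fun w => S' w + X k w)%R.
  by apply/funext => w; rewrite /S big_cons addrC.
have i2 := indep_rest_absorb mUS' kD1 i1.
have l2 := indep_law_absorb kD1 i1.
split.
  apply: (@indep_restW _ _ _ (D1 :\ k)%SET).
    by apply/fintype.subsetP => l; rewrite !inE negb_or => /and3P[-> -> ->].
  pose f (z : (A * R) * R) := (z.1.1, (z.1.2 + z.2)%R).
  have mf : measurable_fun setT f.
    apply: measurable_fun_pair; first by do 2 apply: measurableT_comp => //.
    by apply: measurable_funD => //; exact: measurableT_comp.
  rewrite SE; exact: (indep_rest_comp mf i2).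
move=> W B mW mB.
pose g (z : (A * R) * R) : \bar R := (\1_W z.1.1)%:E * (\1_B (z.1.2 + z.2)%R)%:E.
have mg : measurable_fun setT g.
  apply: emeasurable_funM; apply/measurable_EFinP; apply: measurableT_comp => //.
  - by apply: measurableT_comp.
  - by apply: measurable_funD => //; exact: measurableT_comp.
have g0 z : 0 <= g z by rewrite mule_ge0// lee_fin.
have mWU : measurable (U @^-1` W) by rewrite -[X in measurable X]setTI; exact: mU.
have mSB : measurable (S @^-1` B).
  by rewrite -[X in measurable X]setTI; apply: measurable_sum.
transitivity (\int[P]_w g ((U w, S' w), X k w)).
  transitivity (\int[P]_w (\1_(U @^-1` W `&` S @^-1` B) w)%:E).
    by rewrite integral_indic// ?setIT//; exact: measurableI.
  apply: eq_integral => w _; rewrite /g/= indicI/= SE -EFinM; congr (_ * _)%:E.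
(* The new variable is integrated out first, with (U, S') fixed; then S', with U fixed. *)
rewrite (indep_law_integral mUS' (mX k) l2 mg g0).
have mg' : measurable_fun setT (fun z : A * R => \int[gam]_v g (z, v)).
  exact: measurable_fun_fubini_tonelli_F.
rewrite (indep_law_integral mU mS' l1 mg')/=; last by move=> z; exact: integral_ge0.
set m := size (k' :: c).
pose h v : \bar R := (\1_B v)%:E.
have mh : measurable_fun setT h by exact/measurable_EFinP.
have h0 v : 0 <= h v by rewrite lee_fin.
have inner w : \int[normal_prob 0 (Num.sqrt m%:R)]_s \int[gam]_v g ((U w, s), v) =
    (\1_W (U w))%:E * normal_prob 0 (Num.sqrt m.+1%:R) B.
  have mhs (s : R) : measurable_fun setT (fun v : R => h (s + v)%R).
    by apply: (measurableT_comp mh); apply: measurable_funD.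
  rewrite -natr1 -{2}(sqr_sqrtr (ler0n R m)).
  have -> : normal_prob 0 (Num.sqrt (Num.sqrt m%:R ^+ 2 + 1)) B =
      \int[normal_prob 0 (Num.sqrt m%:R)]_s \int[gam]_v h (s + v)%R.
    by rewrite integral_normal_conv ?sqrtr_gt0 ?ltr0n// integral_indic ?setIT.
  have mhh : measurable_fun setT (fun s : R => \int[gam]_v h (s + v)%R).
    apply: (@measurable_fun_fubini_tonelli_F _ _ _ _ _ gam
      (fun z : measurableTypeR R * measurableTypeR R => h (z.1 + z.2)%R)) => //.
    by apply: (measurableT_comp mh); apply: measurable_funD.
  rewrite -ge0_integralZl//; last by move=> s _; exact: integral_ge0.
  apply: eq_integral => s _; rewrite /g/= ge0_integralZl//; exact: mhs.
transitivity (\int[P]_w ((\1_W (U w))%:E * normal_prob 0 (Num.sqrt m.+1%:R) B)).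
  by apply: eq_integral => w _; exact: inner.
have mUW : measurable_fun setT (fun w => (\1_W (U w) : R)%:E).
  by apply/measurable_EFinP; apply: measurableT_comp.
rewrite ge0_integralZr//; congr (_ * _).
transitivity (\int[P]_w (\1_(U @^-1` W) w)%:E); first by [].
by rewrite integral_indic// setIT.
Qed.

Section product_formula.
Hypothesis X_law : forall k (B : set R), measurable B -> P (X k @^-1` B) = gam B.
Hypothesis X_indep : mutually_independent P X.

(** Start of the absorption: the constant vector, for which the claim is exactly mutual independence
    with standard normal marginals. *)
Lemma indep_rest_cst dA (A : measurableType dA) (a : A) :
  indep_rest (fun _ => a) [set: K]%SET.
Proof.
move=> S B mS mB.
have H : P (sel [set: K]%SET B) = \prod_(k in [set: K]%SET) gam (B k).
  rewrite /sel X_indep//; apply: eq_bigr => k _; exact: X_law.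
have [Sa|Sa] := pselect (S a).
  rewrite (_ : (fun _ => a) @^-1` S = setT) ?setIT ?probability_setT ?mul1e//.
  by apply/seteqP; split.
rewrite (_ : (fun _ => a) @^-1` S = set0) ?setI0 ?measure0 ?mul0e//.
by apply/seteqP; split.
Qed.

Context (I : finType) (c : I -> {set K}).
Hypothesis c_gt0 : forall i, (0 < #|c i|)%N.
Hypothesis c_disj : forall i j k, k \in c i -> k \in c j -> i = j.

Definition block_sum i w := ((Num.sqrt #|c i|%:R)^-1 * \sum_(k in c i) X k w)%R.

Lemma measurable_block_sum i : measurable_fun setT (block_sum i).
Proof.
apply: measurable_funM => //.
under eq_fun do rewrite -big_filter.
exact: measurable_sum.
Qed.

(** Induction over the blocks. The invariant also says that the partial product is independent of
    all variables outside the blocks already used; by disjointness the next block lies among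
    these. *)
Lemma integral_prod_block_sum (g : I -> R -> R) :
  (forall i, measurable_fun setT (g i)) -> (forall i x, (0 <= g i x)%R) ->
  \int[P]_w (\prod_i g i (block_sum i w))%:E = \prod_i \int[gam]_x (g i x)%:E.
Proof.
move=> mg g0.
suff /(_ _ (index_enum_uniq I)) [_ ] : forall r, uniq r ->
  indep_rest (fun w => \prod_(i <- r) g i (block_sum i w))%R
    [set k | [forall i in r, k \notin c i]]%SET /\
  \int[P]_w (\prod_(i <- r) g i (block_sum i w))%:E =
  \prod_(i <- r) \int[gam]_x (g i x)%:E by [].
elim=> [_|j r ih /= /andP[jr ur]].
  split.
    under eq_fun do rewrite big_nil.
    apply: indep_restW (indep_rest_cst _); first exact: finset.subsetT.
  under eq_integral do rewrite big_nil.
  by rewrite big_nil integral_cst// mul1e; exact: probability_setT.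
have [iU eU] := ih ur.
set U := (fun w => \prod_(i <- r) g i (block_sum i w))%R in iU eU.
have mU : measurable_fun setT U.
  by apply: measurable_prod => i _; apply: (measurableT_comp (mg i)); exact: measurable_block_sum.
have U0 w : (0 <= U w)%R by apply: prodr_ge0.
set D := finset _ in iU.
have [k0 [s sE]] : exists k s, enum (c j) = k :: s.
  case E : (enum (c j)) => [|k s]; last by exists k, s.
  by have := c_gt0 j; rewrite cardE E.
have us : uniq (k0 :: s) by rewrite -sE enum_uniq.
have sD : {subset k0 :: s <= D}.
  move=> k; rewrite -sE mem_enum => kj; rewrite inE; apply/forall_inP => i ir.
  by apply: contra jr => ki; rewrite (c_disj kj ki).
have [i1 l1] := indep_rest_sum mU us sD iU.
have szE : size (k0 :: s) = #|c j| by rewrite cardE sE.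
rewrite szE in l1.
have sumE w : (\sum_(k in c j) X k w = \sum_(k <- k0 :: s) X k w)%R.
  by rewrite -sE big_enum.
set S := (fun w => \sum_(k <- k0 :: s) X k w)%R in i1 l1.
have mS : measurable_fun setT S by apply: measurable_sum.
have UE w : (\prod_(i <- j :: r) g i (block_sum i w) =
    g j ((Num.sqrt #|c j|%:R)^-1 * S w) * U w)%R.
  by rewrite big_cons /block_sum sumE.
pose q := (Num.sqrt #|c j|%:R : R).
have q0 : (0 < q)%R by rewrite sqrtr_gt0 ltr0n.
have mq : measurable_fun setT (fun s : R => g j (q^-1 * s)%R).
  by apply: measurableT_comp => //; exact: measurable_funM.
split.
  apply: (@indep_restW _ _ _ [set l in D | l \notin k0 :: s]%SET).
    apply/fintype.subsetP => k; rewrite inE => /forall_inP H.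
    have ks : k \notin k0 :: s by rewrite -sE mem_enum H ?mem_head.
    rewrite finset.in_set ks andbT inE; apply/forall_inP => i ir.
    by apply: H; rewrite inE ir orbT.
  under eq_fun do rewrite UE.
  pose f (z : R * R) := (g j (q^-1 * z.2) * z.1)%R.
  have mf : measurable_fun setT f.
    by apply: measurable_funM => //; apply: (measurableT_comp mq).
  exact: (indep_rest_comp mf i1).
(* [indep_law_integral] wants an integrand nonnegative everywhere; the maximum with 0 ensures this
   and changes nothing on the values of U, which are nonnegative. *)
pose f (z : R * measurableTypeR R) := (g j (q^-1 * z.2))%:E * (Num.max z.1 0)%:E.
have mf : measurable_fun setT f.
  apply: emeasurable_funM; apply/measurable_EFinP.
    by apply: (measurableT_comp mq).
  by apply: measurable_maxr => //.
have f0 z : 0 <= f z by rewrite mule_ge0// lee_fin ?le_max ?lexx ?orbT.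
transitivity (\int[P]_w f (U w, S w)).
  apply: eq_integral => w _; rewrite UE EFinM /f/=; congr (_ * _%:E).
  by rewrite max_l.
rewrite (@indep_law_integral _ _ _ mU _ (normal_prob 0 q) _ mS l1 mf f0).
have mgj : measurable_fun setT (fun x => (g j x)%:E) by exact/measurable_EFinP.
have gj0 x : 0 <= (g j x)%:E by rewrite lee_fin.
transitivity (\int[P]_w ((\int[gam]_x (g j x)%:E) * (U w)%:E)).
  apply: eq_integral => w _; rewrite /f/= max_l; last exact: U0.
  rewrite ge0_integralZr; last 4 first.
  - exact: measurableT.
  - exact/measurable_EFinP.
  - by move=> s' _; exact: gj0.
  - by rewrite lee_fin.
  by rewrite -(integral_normal_scale q0 mgj gj0).
rewrite ge0_integralZl//; last 3 first.
- exact/measurable_EFinP.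
- by move=> w _; rewrite lee_fin.
- by apply: integral_ge0 => x _; exact: gj0.
by rewrite eU big_cons.
Qed.

End product_formula.
End independence.

(** * Truncated squares of a Gaussian variable *)

Section exp_bounds.
Context (R : realType).
Implicit Types x y t : R.

Lemma expR_le_quad x : expR x <= 1 + x + x ^+ 2 * expR `|x|.
Proof.
have [x0|x0] := leP 0 x.
  rewrite ger0_norm//.
  have h1 : 1 - x <= expR (- x) by apply: expR_ge1Dx.
  have h2 : expR (- x) * expR x = 1 by rewrite -expRD addNr expR0.
  have h3 : 1 + x <= expR x by apply: expR_ge1Dx.
  have h4 : (1 - x) * expR x <= 1 by rewrite -[leRHS]h2 ler_wpM2r ?expR_ge0.
  have : x * (expR x - 1) <= x * (x * expR x) by apply: ler_wpM2l => //; lra.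
  lra.
rewrite ltr0_norm//.
have h1 : 1 - x <= expR (- x) by apply: expR_ge1Dx.
have h2 : expR (- x) * expR x = 1 by rewrite -expRD addNr expR0.
have h3 : 1 <= expR (- x) by apply: le_trans h1; lra.
have h4 : (1 - x) * expR x <= 1 by rewrite -[leRHS]h2 ler_wpM2r ?expR_ge0.
have h5 : x ^+ 2 <= x ^+ 2 * expR (- x) by rewrite ler_peMr// sqr_ge0.
(* The right-hand side is 1 - x^3, at least 1 for negative x. *)
have h6 : expR x * (1 - x) <= (1 + x + x ^+ 2) * (1 - x).
  by rewrite mulrC (le_trans h4)//; nra.
have : expR x <= 1 + x + x ^+ 2 by rewrite -(ler_pM2r (_ : 0 < 1 - x))//; lra.
lra.
Qed.

Lemma expR_ge_sqr t : 0 <= t -> t ^+ 2 <= 4 * expR t.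
Proof.
move=> t0; have h1 : 1 + t / 2 <= expR (t / 2) by apply: expR_ge1Dx.
have -> : expR t = expR (t / 2) ^+ 2 by rewrite expr2 -expRD -splitr.
have : (1 + t / 2) ^+ 2 <= expR (t / 2) ^+ 2 by rewrite lerXn2r ?nnegrE//; lra.
nra.
Qed.

Lemma expR_le1Dx_expR x : expR x <= 1 + x * expR x.
Proof.
have h1 : 1 - x <= expR (- x) by apply: expR_ge1Dx.
have h2 : expR (- x) * expR x = 1 by rewrite -expRD addNr expR0.
have : (1 - x) * expR x <= 1 by rewrite -[leRHS]h2 ler_wpM2r ?expR_ge0.
lra.
Qed.
End exp_bounds.

(** * Gaussian expectations of functions dominated by exp(z^2/4) *)

Section gaussian_expectation.
Context (R : realType).
Notation G := (@normal_prob R 0 1).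
Notation esq := (fun z : R => expR (z ^+ 2 / 4)).
Notation esqz z := (expR (z ^+ 2 / 4)).
Implicit Types (f g : R -> R) (z c : R).

Definition gauss_mean f : R := (\int[normal_prob 0 1]_z f z)%R.

Lemma measurable_esq : measurable_fun setT esq.
Proof.
by apply: measurableT_comp => //; apply: measurable_funM => //; exact: measurable_funX.
Qed.

Lemma integrable_esq : G.-integrable setT (EFin \o esq).
Proof.
apply/integrableP; split; first by apply/measurable_EFinP; exact: measurable_esq.
rewrite (_ : (\int[_]_x _)%E = (Num.sqrt 2)%:E) ?ltry//.
rewrite -normal_exp_sqr; apply: eq_integral => z _.
by rewrite /= ger0_norm ?expR_ge0.
Qed.

(* Domination by exp(z^2 / 4), the integrability class of all integrands below. *)
Definition subexp f := measurable_fun setT f /\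
  exists2 c : R, 0 <= c & forall z, `|f z| <= c * esqz z.

Lemma subexp_integrable f : subexp f -> G.-integrable setT (EFin \o f).
Proof.
move=> [mf [c c0 fc]]; apply: (@le_integrable _ _ _ G _ measurableT _
  (fun z => (c * esqz z)%:E)).
- exact/measurable_EFinP.
- by move=> z _; rewrite /= lee_fin ler_normr fc.
- by under eq_fun do rewrite EFinM; apply: integrableZl => //; exact: integrable_esq.
Qed.

Lemma integral_gauss_mean f : subexp f -> (\int[normal_prob 0 1]_z (f z)%:E = (gauss_mean f)%:E)%E.
Proof.
by move=> gf; rewrite /gauss_mean /Rintegral fineK//; apply: integrable_fin_num => //; exact: subexp_integrable.
Qed.

Lemma le_gauss_mean f g : subexp f -> subexp g -> (forall z, f z <= g z) -> gauss_mean f <= gauss_mean g.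
Proof. by move=> *; apply: le_Rintegral => //; exact: subexp_integrable. Qed.

Lemma gauss_meanD f g : subexp f -> subexp g -> gauss_mean (fun z => f z + g z) = gauss_mean f + gauss_mean g.
Proof. by move=> *; apply: RintegralD => //; exact: subexp_integrable. Qed.

Lemma gauss_meanZ c f : subexp f -> gauss_mean (fun z => c * f z) = c * gauss_mean f.
Proof. by move=> *; apply: RintegralZl => //; exact: subexp_integrable. Qed.

Lemma esq_ge1 z : 1 <= esqz z.
Proof. by rewrite -expR0 ler_expR divr_ge0// sqr_ge0. Qed.

Lemma sqr_le_esq z : z ^+ 2 <= 4 * esqz z.
Proof. by have := expR_ge1Dx (z ^+ 2 / 4); lra. Qed.

Lemma gauss_mean_cst c : gauss_mean (fun _ => c) = c.
Proof. by rewrite /gauss_mean Rintegral_cst// [X in fine X]probability_setT mulr1. Qed.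

Lemma gauss_mean_esq : gauss_mean esq = Num.sqrt 2.
Proof. by rewrite /gauss_mean /Rintegral normal_exp_sqr. Qed.

Lemma subexp_esq : subexp esq.
Proof.
split; first exact: measurable_esq.
by exists 1 => // z; rewrite mul1r ger0_norm ?expR_ge0.
Qed.

Lemma subexp_cst c : subexp (fun _ => c).
Proof.
split; first exact: measurable_cst.
by exists `|c| => // z; rewrite ler_peMr// esq_ge1.
Qed.

Lemma subexpD f g : subexp f -> subexp g -> subexp (fun z => f z + g z).
Proof.
move=> [mf [a a0 fa]] [mg [b b0 gb]]; split; first exact: measurable_funD.
exists (a + b); first exact: addr_ge0.
by move=> z; rewrite mulrDl (le_trans (ler_normD _ _))// lerD.
Qed.

Lemma subexpZ c f : subexp f -> subexp (fun z => c * f z).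
Proof.
move=> [mf [a a0 fa]]; split; first exact: measurable_funM.
exists (`|c| * a); first exact: mulr_ge0.
by move=> z; rewrite normrM -mulrA ler_wpM2l.
Qed.

End gaussian_expectation.

(** * Moments and Laplace transforms of truncated squares *)

Section truncated_moments.
Context (R : realType).
Notation esq := (fun z : R => expR (z ^+ 2 / 4)).
Notation esqz z := (expR (z ^+ 2 / 4)).
Implicit Types (t l z m : R).

Let I t z : R := if t < `|z| then 1 else 0.

Let subexpI t : subexp (I t).
Proof.
split; first by apply: measurable_fun_ifT => //; exact: measurable_fun_ltr.
exists 1 => // z; rewrite mul1r /I; case: ifP => _.
  by rewrite normr1 esq_ge1.
by rewrite normr0 expR_ge0.
Qed.

Let subexpIs t : subexp (fun z => I t z * z ^+ 2).
Proof.
split.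
  by apply: measurable_funM; [case: (subexpI t)|exact: measurable_funX].
exists 4 => // z; apply: le_trans (sqr_le_esq z); rewrite /I.
by case: ifP => _; rewrite ?mul0r ?normr0 ?sqr_ge0// mul1r ger0_norm ?sqr_ge0.
Qed.

Lemma measurable_abs_gt t : measurable [set z : R | t < `|z|].
Proof.
rewrite (_ : [set _ | _] = (fun z : R => `|z|) @^-1` `]t, +oo[).
  rewrite -[X in measurable X]setTI; exact: (@normr_measurable R setT).
by apply/seteqP; split => z /=; rewrite in_itv/= andbT.
Qed.

Let pt t : R := fine (normal_prob 0 1 [set z : R | t < `|z|]).

Let ptE t : pt t = gauss_mean (I t).
Proof.
transitivity (\int[normal_prob 0 1]_(z in [set z : R | t < `|z|]) (1 : R)).
  by rewrite Rintegral_cst ?mul1r//; exact: measurable_abs_gt.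
rewrite Rintegral_mkcond; apply: eq_Rintegral => z _; rewrite patchE /I.
by rewrite mem_setE.
Qed.

Let qt t : R := (\int[normal_prob 0 1]_(z in [set z : R | t < `|z|]) z ^+ 2).

Let qtE t : qt t = gauss_mean (fun z => I t z * z ^+ 2).
Proof.
rewrite /qt Rintegral_mkcond; apply: eq_Rintegral => z _; rewrite patchE /I.
rewrite (_ : (z \in _) = (t < `|z|)); last by rewrite mem_setE.
by case: (t < `|z|); rewrite ?mul1r ?mul0r.
Qed.

Let pt_ge t : 0 <= t -> (Num.sqrt (pi *+ 2))^-1 * expR (- ((t + 1) ^+ 2 / 2)) <= pt t.
Proof.
move=> t0.
have mD := measurable_abs_gt t.
have mJ : measurable (`]t, t + 1]%classic : set R) by exact: measurable_itv.
rewrite -lee_fin /pt fineK; last exact: fin_num_measure.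
set k := _ * _.
apply: (@le_trans _ _ (normal_prob 0 1 (`]t, t + 1]%classic : set R))); last first.
  apply: le_measure; rewrite ?inE//.
  move=> z /=; rewrite in_itv/= => /andP[tz _].
  by rewrite (lt_le_trans tz)// ler_norm.
apply: (@le_trans _ _ (\int[lebesgue_measure]_(z in `]t, (t + 1)%R]) k%:E)%E).
  rewrite integral_cst//= lebesgue_measure_itv/= lte_fin ltrDl ltr01 -EFinD.
  by rewrite addrAC subrr add0r mule1.
apply: ge0_le_integral => //.
- by move=> z _; rewrite lee_fin mulr_ge0 ?expR_ge0 ?invr_ge0.
- by apply/measurable_EFinP; apply: measurable_funTS; exact: measurable_normal_pdf.
- move=> z /=; rewrite in_itv/= => /andP[tz zt]; rewrite lee_fin normal_pdfE1//.
  rewrite divr1 /k ler_wpM2l ?invr_ge0// ler_expR expr1n subr0 mulNr lerN2.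
  by rewrite ler_wpM2r// lerXn2r ?nnegrE//; lra.
Qed.

(* The bound compares P(|Z| > t) >= P(t < Z <= t + 1) with the tail of Z^2 beyond
   4 (t + 1)^2. *)
Definition nu_const : R := 8 + 8 * Num.sqrt 2 * Num.sqrt (pi *+ 2).

Lemma nu_const_ge8 : 8 <= nu_const. Proof. by rewrite /nu_const lerDl !mulr_ge0. Qed.

Let pt_gt0 t : 0 <= t -> 0 < pt t.
Proof.
move=> t0; apply: lt_le_trans (pt_ge t0); rewrite mulr_gt0 ?expR_gt0//.
by rewrite invr_gt0 sqrtr_gt0 mulrn_wgt0// pi_gt0.
Qed.

Lemma nu_ge0 t : 0 <= nu t.
Proof.
rewrite /nu -/(qt t) -/(pt t) divr_ge0//; last exact: fine_ge0.
by apply: Rintegral_ge0 => z _; exact: sqr_ge0.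
Qed.

Lemma nu_le t : 0 <= t -> nu t <= nu_const * (1 + t ^+ 2).
Proof.
move=> t0; rewrite /nu -/(qt t) -/(pt t) ler_pdivrMr ?pt_gt0//.
set c0 := Num.sqrt (pi *+ 2 : R).
have c00 : 0 < c0 by rewrite sqrtr_gt0 mulrn_wgt0// pi_gt0.
set e := expR (- ((t + 1) ^+ 2 / 2)).
have qle : qt t <= 4 * (t + 1) ^+ 2 * pt t + 8 * e * Num.sqrt 2.
  rewrite qtE ptE -gauss_meanZ// -gauss_mean_esq -gauss_meanZ; last exact: subexp_esq.
  rewrite -gauss_meanD; [|exact: subexpZ|by apply: subexpZ; exact: subexp_esq].
  apply: le_gauss_mean => //.
    by apply: subexpD; [exact: subexpZ|by apply: subexpZ; exact: subexp_esq].
  move=> z; rewrite /I; case: ifP => _; last first.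
    by rewrite mul0r mulr0 add0r !mulr_ge0// expR_ge0.
  rewrite mul1r mulr1; have [zt|zt] := leP (z ^+ 2) (4 * (t + 1) ^+ 2).
    by rewrite (le_trans zt)// lerDl !mulr_ge0// expR_ge0.
  (* Here z^2/8 exceeds (t + 1)^2/2, so z^2 <= 8 exp(z^2/8) <= 8 e exp(z^2/4). The factor e is
     comparable to P(|Z| > t) by [pt_ge]. *)
  apply: (@le_trans _ _ (8 * e * esqz z)); last first.
    by rewrite lerDr mulr_ge0// sqr_ge0.
  rewrite -mulrA -expRD.
  have : 1 + z ^+ 2 / 8 <= expR (z ^+ 2 / 8) by apply: expR_ge1Dx.
  have : expR (z ^+ 2 / 8) <= expR (- ((t + 1) ^+ 2 / 2) + z ^+ 2 / 4).
    by rewrite ler_expR; lra.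
  lra.
have ple : e <= c0 * pt t.
  by rewrite -ler_pdivrMl//; exact: pt_ge.
have p0 := pt_gt0 t0.
have s2 : 0 <= Num.sqrt 2 :> R by exact: sqrtr_ge0.
have h1 : 8 * e * Num.sqrt 2 <= 8 * Num.sqrt 2 * c0 * pt t.
  by rewrite mulrAC -[leRHS]mulrA ler_wpM2l// mulr_ge0.
have h2 : 4 * (t + 1) ^+ 2 <= 8 * (1 + t ^+ 2) by have := sqr_ge0 (t - 1); lra.
apply: (le_trans qle).
have h3 : 4 * (t + 1) ^+ 2 * pt t <= 8 * (1 + t ^+ 2) * pt t by rewrite ler_wpM2r// ltW.
have h4 : 0 <= 8 * Num.sqrt 2 * c0 * pt t * t ^+ 2.
  by rewrite !mulr_ge0 ?sqr_ge0// ltW.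
rewrite /nu_const -/c0; nra.
Qed.

Let truncE t z : truncated t z = I t z * z ^+ 2 + (- nu t) * I t z.
Proof. by rewrite /truncated /I; case: ifP => _; ring. Qed.

Lemma subexp_truncated t : subexp (truncated t).
Proof.
rewrite (_ : truncated t = fun z => I t z * z ^+ 2 + (- nu t) * I t z).
  by apply: subexpD => //; exact: subexpZ.
by apply/funext => z; exact: truncE.
Qed.

Lemma gauss_mean_truncated t : 0 <= t -> gauss_mean (truncated t) = 0.
Proof.
move=> t0; rewrite (_ : truncated t = fun z => I t z * z ^+ 2 + (- nu t) * I t z).
  rewrite gauss_meanD//; last exact: subexpZ.
  rewrite gauss_meanZ// -ptE -qtE /nu -/(qt t) -/(pt t) mulNr divfK ?subrr// gt_eqF//.
  exact: pt_gt0.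
by apply/funext => z; exact: truncE.
Qed.

Lemma normr_truncated_le t z : 0 <= t -> `|truncated t z| <= nu_const * (1 + z ^+ 2).
Proof.
move=> t0; have k8 := nu_const_ge8; have z2 := sqr_ge0 z; rewrite /truncated.
case: ifPn => [tz|_]; last by rewrite normr0 mulr_ge0//; lra.
have tz2 : t ^+ 2 <= z ^+ 2 by rewrite -(real_normK (num_real z)) lerXn2r ?nnegrE// ltW.
have := nu_le t0; have := nu_ge0 t => n0 n1.
have h : nu_const * (1 + t ^+ 2) <= nu_const * (1 + z ^+ 2) by rewrite ler_wpM2l; lra.
by rewrite ler_norml; apply/andP; split; nra.
Qed.

Lemma truncated_ge t y : 0 <= t -> y ^+ 2 - nu t - t ^+ 2 <= truncated t y.
Proof.
move=> t0; have n0 := nu_ge0 t; rewrite /truncated; case: ifPn => [_|].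
  by have := sqr_ge0 t; lra.
rewrite -leNgt => yt.
have : y ^+ 2 <= t ^+ 2 by rewrite -(real_normK (num_real y)) lerXn2r ?nnegrE.
lra.
Qed.

(** The radius forces |l * truncated t z| <= (1 + z^2)/16, so that two such exponentials still fit
    under exp(z^2/4) with a factor exp(-z^2/8) to spare. *)
Definition mgf_radius : R := (16 * nu_const)^-1.
(** 1024 = 4 * 16^2 comes from [expR_ge_sqr] at (1 + z^2)/16, and sqrt 2 is the mean of
    exp(Z^2/4). *)
Definition mgf_const : R := 1024 * nu_const ^+ 2 * expR (1 / 8) * Num.sqrt 2.

Lemma mgf_radius_gt0 : 0 < mgf_radius.
Proof. by rewrite invr_gt0; have := nu_const_ge8; lra. Qed.

Lemma mgf_radius_le : mgf_radius <= 8^-1.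
Proof. by rewrite lef_pV2 ?posrE//; have := nu_const_ge8; lra. Qed.

Let c1024 : 0 <= 1024 :> R. Proof. exact: ler0n. Qed.

Lemma mgf_const_ge0 : 0 <= mgf_const.
Proof.
exact: (mulr_ge0 (mulr_ge0 (mulr_ge0 c1024 (sqr_ge0 _)) (expR_ge0 _)) (sqrtr_ge0 _)).
Qed.

(** In exp(x) <= 1 + x + x^2 exp|x| the linear term has mean zero by the choice of nu, and the
    quadratic one vanishes unless |z| > t. *)
Lemma truncated_mgf t l : 0 <= t -> `|l| <= mgf_radius ->
  (\int[normal_prob 0 1]_z (expR (l * truncated t z))%:E <=
   (expR (mgf_const * l ^+ 2 * expR (- (t ^+ 2 / 8))))%:E)%E.
Proof.
move=> t0 ll0; have k8 := nu_const_ge8.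
pose k := 1024 * nu_const ^+ 2 * expR (1 / 8) * (l ^+ 2 * expR (- (t ^+ 2 / 8))).
have k0 : 0 <= k.
  exact: (mulr_ge0 (mulr_ge0 (mulr_ge0 c1024 (sqr_ge0 _)) (expR_ge0 _))
    (mulr_ge0 (sqr_ge0 _) (expR_ge0 _))).
have gt := subexp_truncated t.
have gg : subexp (fun z => (1 + l * truncated t z) + k * esqz z).
  apply: subexpD; last by apply: subexpZ; exact: subexp_esq.
  by apply: subexpD; [exact: subexp_cst|exact: subexpZ].
have [mt _] := gt.
have le z : expR (l * truncated t z) <= (1 + l * truncated t z) + k * esqz z.
  apply: le_trans (expR_le_quad _) _; rewrite lerD2l.
  have z2 := sqr_ge0 z.
  have [tz|tz] := ltP t `|z|; last first.
    by rewrite /truncated ltNge tz/= mulr0 expr0n mul0r mulr_ge0// expR_ge0.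
  set x := l * _.
  have xle : `|x| <= (1 + z ^+ 2) / 16.
    rewrite normrM; apply: (@le_trans _ _ (mgf_radius * (nu_const * (1 + z ^+ 2)))).
      by apply: ler_pM => //; exact: normr_truncated_le.
    rewrite /mgf_radius invfM mulrA mulfVK; last by rewrite gt_eqF//; lra.
    by rewrite mulrC.
  have x2 : x ^+ 2 <= l ^+ 2 * nu_const ^+ 2 * (1024 * expR ((1 + z ^+ 2) / 16)).
    rewrite exprMn -mulrA ler_wpM2l ?sqr_ge0//.
    apply: (@le_trans _ _ ((nu_const * (1 + z ^+ 2)) ^+ 2)).
      rewrite -[leLHS](real_normK (num_real _)) lerXn2r ?nnegrE ?normr_truncated_le//.
      by rewrite mulr_ge0; lra.
    rewrite exprMn ler_wpM2l ?sqr_ge0//.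
    have : ((1 + z ^+ 2) / 16) ^+ 2 <= 4 * expR ((1 + z ^+ 2) / 16).
      by apply: expR_ge_sqr; lra.
    by rewrite expr_div_n; lra.
  have e1 : expR `|x| <= expR ((1 + z ^+ 2) / 16) by rewrite ler_expR.
  apply: (le_trans (ler_pM _ _ x2 e1)); rewrite ?sqr_ge0 ?expR_ge0//.
  (* Since z^2 >= t^2, the exponent (1 + z^2)/8 = 1/8 - z^2/8 + z^2/4 is at most 1/8 - t^2/8 +
     z^2/4. *)
  have e2 : expR ((1 + z ^+ 2) / 16) * expR ((1 + z ^+ 2) / 16) <=
      expR (1 / 8) * (expR (- (t ^+ 2 / 8)) * esqz z).
    rewrite -!expRD ler_expR.
    have tz2 : t ^+ 2 <= z ^+ 2.
      by rewrite -(real_normK (num_real z)) lerXn2r ?nnegrE// ltW.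
    lra.
  have aux (a b c d l2 k2 : R) : 0 <= l2 -> 0 <= k2 -> a * a <= b * (c * d) ->
      l2 * k2 * (1024 * a) * a <= 1024 * k2 * b * (l2 * c) * d.
    move=> l20 k20 /(ler_wpM2l (mulr_ge0 (mulr_ge0 l20 k20) c1024)); lra.
  exact: (aux _ _ _ _ _ _ (sqr_ge0 l) (sqr_ge0 nu_const) e2).
apply: (@le_trans _ _ (\int[normal_prob 0 1]_z ((1 + l * truncated t z) + k * esqz z)%:E)%E).
  apply: ge0_le_integral => //.
  - apply/measurable_EFinP; apply: measurableT_comp => //; exact: measurable_funM.
  - by apply/measurable_EFinP; case: gg.
  - by move=> z _; rewrite lee_fin.
rewrite integral_gauss_mean// lee_fin gauss_meanD; [|by apply: subexpD; [exact: subexp_cst|exact: subexpZ]|by apply: subexpZ; exact: subexp_esq].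
rewrite gauss_meanD; [|exact: subexp_cst|exact: subexpZ].
rewrite !gauss_meanZ ?gauss_mean_truncated ?gauss_mean_esq ?gauss_mean_cst//; last exact: subexp_esq.
rewrite mulr0 addr0 (le_trans _ (expR_ge1Dx _))// lerD2l /k /mgf_const.
lra.
Qed.

(** [nu_const] + 1 bounds nu t + t^2 per unit of 1 + t^2; the other 16 pays for E exp(l Z^2) <=
    exp(16 l). *)
Definition signal_const : R := nu_const + 17.

Lemma signal_const_ge0 : 0 <= signal_const. Proof. by rewrite /signal_const; have := nu_const_ge8; lra. Qed.

Lemma truncated_signal_mgf t l m : 0 <= t -> 0 <= l <= 8^-1 ->
  (\int[normal_prob 0 1]_z (expR (- l * truncated t (m + z)))%:E <=
   (expR (- (l * (m ^+ 2 / 2 - signal_const * (1 + t ^+ 2)))))%:E)%E.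
Proof.
move=> t0 /andP[l_0 l8]; have k8 := nu_const_ge8.
set b := m ^+ 2 / 2 - (nu_const + 1) * (1 + t ^+ 2).
have gg : subexp (fun z => expR (- (l * b)) * (1 + 8 * l * esqz z)).
  apply: subexpZ; apply: subexpD; first exact: subexp_cst.
  by apply: subexpZ; exact: subexp_esq.
apply: (@le_trans _ _ (\int[normal_prob 0 1]_z (expR (- (l * b)) * (1 + 8 * l * esqz z))%:E)%E).
  apply: ge0_le_integral => //.
  - apply/measurable_EFinP; apply: measurableT_comp => //; apply: measurable_funM => //.
    apply: (measurableT_comp (measurable_truncated t)); exact: measurable_funD.
  - by apply/measurable_EFinP; case: gg.
  - move=> z _; rewrite lee_fin.
    apply: (@le_trans _ _ (expR (- (l * b)) * expR (l * z ^+ 2))).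
      rewrite -expRD ler_expR.
      have h1 := @truncated_ge t (m + z) t0.
      have h2 := nu_le t0.
      (* Signal and noise separate by (m + z)^2 - m^2/2 + z^2 = (m + 2z)^2/2 >= 0. *)
      have h3 : b - z ^+ 2 <= truncated t (m + z).
        apply: le_trans h1; have := sqr_ge0 (m + 2 * z); rewrite /b.
        by have := sqr_ge0 t; nra.
      have := ler_wpM2l l_0 h3; lra.
    rewrite ler_wpM2l ?expR_ge0//; apply: le_trans (expR_le1Dx_expR _) _.
    rewrite lerD2l; have z2 := sqr_ge0 z.
    have e1 : 1 + z ^+ 2 / 8 <= expR (z ^+ 2 / 8) by apply: expR_ge1Dx.
    (* This is where l <= 1/8 is used; the remaining factor z^2 costs another exp(z^2/8), which
       fills up exp(z^2/4). *)
    have e2 : expR (l * z ^+ 2) <= expR (z ^+ 2 / 8) by rewrite ler_expR; nra.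
    have e3 : esqz z = expR (z ^+ 2 / 8) * expR (z ^+ 2 / 8).
      by rewrite -expRD; congr expR; lra.
    have aux (a e y : R) : 0 <= a -> 0 <= y -> 1 + y / 8 <= e -> a <= e ->
        l * y * a <= 8 * l * (e * e).
      move=> a0 y0 ye ae; have ya : y * a <= (8 * e) * e by apply: ler_pM => //; lra.
      have := ler_wpM2l l_0 ya; lra.
    by rewrite e3; apply: aux => //; exact: expR_ge0.
rewrite integral_gauss_mean// lee_fin gauss_meanZ; last first.
  by apply: subexpD; [exact: subexp_cst|apply: subexpZ; exact: subexp_esq].
rewrite gauss_meanD; [|exact: subexp_cst|by apply: subexpZ; exact: subexp_esq].
rewrite gauss_meanZ ?gauss_mean_esq ?gauss_mean_cst; last exact: subexp_esq.
have s2 : Num.sqrt 2 <= 2 :> R.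
  by rewrite -(@ler_pXn2r _ 2)// ?nnegrE ?sqrtr_ge0// sqr_sqrtr//; lra.
apply: (@le_trans _ _ (expR (- (l * b)) * expR (16 * l))).
  rewrite ler_wpM2l ?expR_ge0// (le_trans _ (expR_ge1Dx _))// lerD2l.
  by nra.
rewrite -expRD ler_expR /b /signal_const.
have := mulr_ge0 l_0 (sqr_ge0 t); lra.
Qed.

End truncated_moments.

(** * Chernoff bound for the column sums *)

Section union_bound.
Context (R : realType) d (T : measurableType d) (P : probability T R).

Lemma union_bound (I : finType) (Q : {pred I}) (F : I -> set T) (b : R) :
  (forall i, measurable (F i)) -> (forall i, i \in Q -> (P (F i) <= b%:E)%E) ->
  (P [set w | exists2 i, i \in Q & F i w] <= (#|Q|%:R * b)%:E)%E.
Proof.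
move=> mF Fb; rewrite cardE.
rewrite [X in P X](_ : _ = \big[setU/set0]_(i <- enum Q) F i); last first.
  rewrite -bigcup_seq; apply/seteqP; split => w /= [i iQ Fi]; exists i => //=.
    by rewrite mem_enum.
  by move: iQ; rewrite /= mem_enum.
have : {subset enum Q <= Q} by move=> i; rewrite mem_enum.
elim: (enum Q) => [_|i r ih rQ]; first by rewrite big_nil measure0 mul0r.
rewrite big_cons (le_trans (measureU2 _ _ _))//.
  by apply: bigsetU_measurable.
rewrite /= -natr1 mulrDl mul1r addrC EFinD leeD ?Fb ?rQ ?mem_head ?ih//.
by move=> j jr; rewrite rQ// inE jr orbT.
Qed.
End union_bound.

Section chernoff.
Context (R : realType) d (T : measurableType d) (P : probability T R).
Context (d1 d2 : nat).

(** A form of [iid_std_normal] for plain functions, which passes to the transposed noise without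
    rebuilding a random variable. *)
Definition iid_entries (E : T -> 'M[R]_(d1, d2)) :=
  [/\ forall i j, measurable_fun setT (fun w => E w i j),
      forall i j (A : set R), measurable A ->
        P [set w | A (E w i j)] = normal_prob 0 1 A &
      mutually_independent P (fun (k : 'I_d1 * 'I_d2) w => E w k.1 k.2)].

Variable E : T -> 'M[R]_(d1, d2).
Hypothesis hE : iid_entries E.

Lemma measurable_sub_col_sum_noise s J j :
  measurable_fun setT (fun w => sub_col_sum s J (E w) j).
Proof.
have [mE _ _] := hE; apply: measurable_funM => //.
under eq_fun do rewrite -big_filter.
by apply: measurable_sum => i; exact: mE.
Qed.

Lemma measurable_noise_sum s J (f : 'I_d2 -> R -> R) :
  (forall j, measurable_fun setT (f j)) ->
  measurable_fun setT (fun w => \sum_j f j (sub_col_sum s J (E w) j)).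
Proof.
move=> mf; apply: measurable_sum => j.
by apply: (measurableT_comp (mf j)); exact: measurable_sub_col_sum_noise.
Qed.

(** The sets J x {j} are disjoint blocks, so the exponential moment factors over the columns. The
    factor lambda is part of f, and f, b vary with j because columns with and without signal are
    bounded differently. *)
Lemma noise_chernoff s (J : {set 'I_d1}) (f : 'I_d2 -> R -> R) (b : 'I_d2 -> R) (a : R) :
  #|J| = s -> (0 < s)%N -> (forall j, measurable_fun setT (f j)) ->
  (forall j, \int[normal_prob 0 1]_z (expR (f j z))%:E <= (expR (b j))%:E)%E ->
  (P [set w | (a <= \sum_j f j (sub_col_sum s J (E w) j))%R] <=
    (expR (\sum_j b j - a))%:E)%E.
Proof.
move=> Js s0 mf fb; have [mE lE iE] := hE.
pose X (k : 'I_d1 * 'I_d2) w := E w k.1 k.2.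
pose c (j : 'I_d2) : {set 'I_d1 * 'I_d2} := finset.setX J [set j]%SET.
have cJ j : #|c j| = s by rewrite cardsX cards1 muln1.
have ZE j w : sub_col_sum s J (E w) j = block_sum X c j w.
  rewrite /sub_col_sum /block_sum cJ; congr (_ * _).
  rewrite (eq_bigl (fun p => (p.1 \in J) && (p.2 \in [set j]%SET))); last first.
    by move=> [i j']; rewrite /c finset.in_setX.
  rewrite -(pair_big (fun i => i \in J) (fun j' => j' \in [set j]%SET)
     (fun i j' => E w i j'))/=.
  by apply: eq_bigr => i _; rewrite big_set1.
set Y := fun w => \sum_j f j (sub_col_sum s J (E w) j).
have mY : measurable_fun setT Y by exact: measurable_noise_sum.
have mA : measurable [set w | a <= Y w].
  rewrite (_ : [set w | _] = Y @^-1` `[a, +oo[).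
    by rewrite -[X in measurable X]setTI; exact: mY.
  by apply/seteqP; split => w /=; rewrite in_itv/= andbT.
have meY : measurable_fun setT (fun w => (expR (Y w))%:E).
  by apply/measurable_EFinP; exact: measurableT_comp.
have intY : (\int[P]_w (expR (Y w))%:E <= (expR (\sum_j b j))%:E)%E.
  have -> : (\int[P]_w (expR (Y w))%:E =
      \prod_j \int[normal_prob 0 1]_z (expR (f j z))%:E)%E.
    have mX k : measurable_fun setT (X k) by exact: mE.
    have lX k (B : set R) : measurable B -> P (X k @^-1` B) = normal_prob 0 1 B.
      by move=> mB; exact: lE.
    have c0 j : (0 < #|c j|)%N by rewrite cJ.
    have cI j j' k : k \in c j -> k \in c j' -> j = j'.
      rewrite /c; case: k => i k; rewrite !finset.in_setX /= !finset.in_set1.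
      by move=> /andP[_ /eqP <-] /andP[_ /eqP <-].
    have mg j : measurable_fun setT (fun z => expR (f j z)) by exact: measurableT_comp.
    have g0 j x : 0 <= expR (f j x) by exact: expR_ge0.
    rewrite -(integral_prod_block_sum mX lX iE c0 cI mg g0).
    apply: eq_integral => w _; rewrite /Y expR_sum; congr EFin.
    by apply: eq_bigr => j _; rewrite ZE.
  rewrite expR_sum -prodEFin.
  suff /andP[] : (0 <= \prod_j \int[normal_prob 0 1]_z (expR (f j z))%:E <=
    \prod_j (expR (b j))%:E)%E by [].
  apply: (big_ind2 (fun x y => 0 <= x <= y)%E).
  - by rewrite lee01 lexx.
  - move=> x1 x2 y1 y2 /andP[x0 xx] /andP[y0 yy].
    by rewrite mule_ge0//= lee_pmul.
  - move=> j _; rewrite fb andbT; apply: integral_ge0 => z _.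
    by rewrite lee_fin expR_ge0.
rewrite expRD EFinM muleC.
apply: (@le_trans _ _ ((expR (- a))%:E * \int[P]_w (expR (Y w))%:E)%E); last first.
  by rewrite lee_wpmul2l// lee_fin expR_ge0.
rewrite -ge0_integralZl//.
apply: (@le_trans _ _ (\int[P]_w (\1_[set w | (a <= Y w)%R] w)%:E)%E).
  by rewrite integral_indic// setIT.
apply: ge0_le_integral => //.
- by apply/measurable_EFinP; exact: measurable_indic.
- exact: emeasurable_funM.
- move=> w _; rewrite -EFinM lee_fin -expRD indicE; case: (boolP (w \in _)) => [|_].
    rewrite inE /= => aY; rewrite -[leLHS]expR0 ler_expR; lra.
  exact: expR_ge0.
Qed.
End chernoff.

(** * Tails under the null and the alternative *)

(** Its two consequences serve the two regimes of the tests: for x >= 1 the logarithm absorbs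
    constants, for x <= 1 it is of order x. *)
Lemma ln1D_ge (R : realType) (x : R) : 0 <= x -> x / (1 + x) <= ln (1 + x).
Proof.
move=> x0; have x1 : 0 < 1 + x by lra.
rewrite -[leLHS]expRK ler_ln ?posrE ?expR_gt0//.
have h : 1 + - (x / (1 + x)) <= expR (- (x / (1 + x))) by apply: expR_ge1Dx.
have h2 : expR (- (x / (1 + x))) * expR (x / (1 + x)) = 1 by rewrite -expRD addNr expR0.
have h3 : 1 + - (x / (1 + x)) = (1 + x)^-1 by field; rewrite gt_eqF.
rewrite h3 in h.
have : (1 + x)^-1 * expR (x / (1 + x)) <= 1 by rewrite -[leRHS]h2 ler_wpM2r ?expR_ge0.
by rewrite ler_pdivrMl// mulr1.
Qed.

Lemma ln1D_ge_half (R : realType) (x : R) : 1 <= x -> 1 / 2 <= ln (1 + x).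
Proof.
move=> x1; apply: le_trans (ln1D_ge _); last lra.
rewrite ler_pdivlMr; lra.
Qed.

Lemma ln1D_ge_lin (R : realType) (x : R) : 0 <= x <= 1 -> x / 2 <= ln (1 + x).
Proof.
move=> /andP[x0 x1]; apply: le_trans (ln1D_ge x0).
by rewrite ler_wpM2l// lef_pV2 ?posrE; lra.
Qed.

Section level_sets.
Context (R : realType) d (T : measurableType d) (f : T -> R).
Hypothesis mf : measurable_fun setT f.

Lemma measurable_set_gt a : measurable [set w | a < f w].
Proof.
rewrite (_ : [set w | _] = f @^-1` `]a, +oo[).
  by rewrite -[X in measurable X]setTI; exact: mf.
by apply/seteqP; split => w /=; rewrite in_itv/= andbT.
Qed.

Lemma measurable_set_ge a : measurable [set w | a <= f w].
Proof.
rewrite (_ : [set w | _] = f @^-1` `[a, +oo[).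
  by rewrite -[X in measurable X]setTI; exact: mf.
by apply/seteqP; split => w /=; rewrite in_itv/= andbT.
Qed.

Lemma measurable_set_le a : measurable [set w | f w <= a].
Proof.
rewrite (_ : [set w | _] = f @^-1` `]-oo, a]).
  by rewrite -[X in measurable X]setTI; exact: mf.
by apply/seteqP; split => w /=; rewrite in_itv/=.
Qed.

End level_sets.

(* Otherwise conversion unfolds the numeral 1024 of mgf_const in unary. *)
Opaque mgf_const signal_const mgf_radius.

Section tails.
Context (R : realType) d (T : measurableType d) (P : probability T R).
Context (d1 n : nat) (E : T -> 'M[R]_(d1, n)).
Hypothesis hE : iid_entries P E.
Notation mgf_const := (@mgf_const R).
Notation mgf_radius := (@mgf_radius R).
Notation signal_const := (@signal_const R).
Implicit Types (A l h : R).

(** Solves [mgf_radius] * c * l/2 = [mgf_const] * [mgf_radius]^2 * l + A l for c: the gain in the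
    exponent covers the variance term and leaves A l. *)
Definition tail_const A : R := 2 * (mgf_const * mgf_radius + A / mgf_radius).

Lemma tail_const_ge0 A : 0 <= A -> 0 <= tail_const A.
Proof.
move=> A0; have lp := ltW (mgf_radius_gt0 R).
exact: (mulr_ge0 (ler0n _ 2) (addr_ge0 (mulr_ge0 (mgf_const_ge0 R) lp) (divr_ge0 A0 lp))).
Qed.

Section trunc.
Variables (r : nat) (J : {set 'I_d1}) (s : nat) (l x : R).
Hypotheses (Jr : #|J| = r) (r0 : (0 < r)%N) (s0 : (0 < s)%N).
Hypotheses (l1 : 1 <= l) (xE : x = n%:R / s%:R ^+ 2 * l) (x1 : 1 <= x).
Let L := ln (1 + x).
Let t := Num.sqrt (8 * L).

Let L_ge : 1 / 2 <= L. Proof. exact: ln1D_ge_half. Qed.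
Let t0 : 0 <= t. Proof. exact: sqrtr_ge0. Qed.
Let t2 : t ^+ 2 = 8 * L. Proof. by rewrite sqr_sqrtr//; have := L_ge; lra. Qed.
Let s1 : 1 <= s%:R :> R. Proof. by rewrite ler1n. Qed.

Let et : expR (- (t ^+ 2 / 8)) = (1 + x)^-1.
Proof.
have -> : - (t ^+ 2 / 8) = - L by rewrite t2; lra.
have xp : 0 < 1 + x by have := x1; lra.
by rewrite expRN lnK.
Qed.

(* The truncation makes the variance proxy of the whole sum at most s^2 / l. *)
Let noise_var : n%:R * expR (- (t ^+ 2 / 8)) <= s%:R ^+ 2 / l.
Proof.
have x1' := x1; have l1' := l1; have s1' := s1; have L' := L_ge.
have sp : 0 < s%:R :> R by lra.
have lp : 0 < l by lra.
rewrite et ler_pdivrMr; last lra.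
have -> : s%:R ^+ 2 / l * (1 + x) = s%:R ^+ 2 / l + n%:R.
  by rewrite xE; field; rewrite !gt_eqF.
by rewrite lerDr divr_ge0 ?sqr_ge0// ltW.
Qed.

Lemma null_trunc A h : 0 <= A -> tail_const A * (s%:R * L + l) <= h ->
  (P [set w | (h < \sum_j truncated t (sub_col_sum r J (E w) j))%R] <=
   (expR (- (A * l)))%:E)%E.
Proof.
have x1' := x1; have l1' := l1; have s1' := s1; have L' := L_ge.
(* u <= 1 keeps lambda within the radius and u <= l/s keeps the variance term u^2 s^2/l below l. In
   either case u (s L + l) >= l/2, by L >= 1/2 when u = l/s. *)
move=> A0 hh; set u := Num.min 1 (l / s%:R).
have sp : 0 < s%:R :> R by lra.
have u0 : 0 < u by rewrite lt_min ltr01 divr_gt0//; lra.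
have lp := mgf_radius_gt0 R; have k2 := mgf_const_ge0 R.
have u1 : u <= 1 by rewrite ge_min lexx.
have us : u * s%:R <= l.
  by rewrite -ler_pdivlMr// ge_min lexx orbT.
have uL : l / 2 <= u * (s%:R * L + l).
  have : u = 1 \/ u = l / s%:R by rewrite /u; case: leP => _; [left|right].
  have sL : 0 <= s%:R * L by rewrite mulr_ge0//; lra.
  case=> ->; first lra.
  have -> : l / s%:R * (s%:R * L + l) = l * L + l * l / s%:R by field; rewrite gt_eqF.
  have : 0 <= l * l / s%:R by rewrite divr_ge0// mulr_ge0//; lra.
  have : l * (1 / 2) <= l * L by rewrite ler_wpM2l//; lra.
  lra.
set lam := mgf_radius * u.
have lam0 : 0 < lam by rewrite mulr_gt0.
pose f (j : 'I_n) z := lam * truncated t z.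
have mf j : measurable_fun setT (f j) by apply: measurable_funM => //; exact: measurable_truncated.
pose b (j : 'I_n) := mgf_const * lam ^+ 2 * expR (- (t ^+ 2 / 8)).
have fb j : (\int[normal_prob 0 1]_z (expR (f j z))%:E <= (expR (b j))%:E)%E.
  by apply: truncated_mgf => //; rewrite gtr0_norm// /lam ger_pMr.
apply: le_trans (le_trans (noise_chernoff hE (lam * h) Jr r0 mf fb) _).
  apply: le_measure; rewrite ?inE.
  - apply: measurable_set_gt; apply: (measurable_noise_sum hE r J (f := fun _ => truncated t)).
    by move=> _; exact: measurable_truncated.
  - by apply: measurable_set_ge; exact: (measurable_noise_sum hE r J mf).
  - by move=> w /= hw; rewrite -mulr_sumr ler_wpM2l// ltW.
rewrite lee_fin ler_expR sumr_const card_ord /b.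
have key : mgf_const * lam ^+ 2 * (s%:R ^+ 2 / l) <= mgf_const * mgf_radius ^+ 2 * l.
  have -> : mgf_const * lam ^+ 2 * (s%:R ^+ 2 / l) = (mgf_const * mgf_radius ^+ 2) * ((u * s%:R) ^+ 2 / l).
    by rewrite /lam; field; rewrite gt_eqF//; lra.
  apply: ler_wpM2l; first exact: (mulr_ge0 k2 (sqr_ge0 _)).
  rewrite ler_pdivrMr; last lra.
  by rewrite expr2 ler_pM// mulr_ge0// ltW.
have nv := ler_wpM2l (mulr_ge0 k2 (sqr_ge0 lam)) noise_var.
have lh : lam * (tail_const A * (s%:R * L + l)) <= lam * h by rewrite ler_wpM2l// ltW.
have HA := tail_const_ge0 A0.
have lu : mgf_radius * tail_const A * (l / 2) <= lam * (tail_const A * (s%:R * L + l)).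
  have := ler_wpM2l (mulr_ge0 (ltW lp) HA) uL; rewrite /lam; lra.
have HE : mgf_radius * tail_const A * (l / 2) = mgf_const * mgf_radius ^+ 2 * l + A * l.
  by rewrite /tail_const; field; rewrite gt_eqF.
rewrite -[X in X - _]mulr_natl; lra.
Qed.

(** With lambda = [mgf_radius] / s the variance term is bounded by a constant. The signal has to
    beat the cutoff (B), the centring and truncation losses (10 [signal_const]) and the tail; the
    factor 2 undoes the m^2/2 of [truncated_signal_mgf]. *)
Lemma alt_trunc A B (m : 'I_n -> R) (S : {set 'I_n}) (M2 h : R) :
  0 <= A -> #|S| = s -> (forall j, j \notin S -> m j = 0) ->
  (forall j, j \in S -> M2 <= m j ^+ 2) ->
  2 * (B + 10 * signal_const + tail_const A) * (s%:R * L + l) <= s%:R * M2 ->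
  h <= B * (s%:R * L + l) ->
  (P [set w | (\sum_j truncated t (m j + sub_col_sum r J (E w) j) <= h)%R] <=
   (expR (- A))%:E)%E.
Proof.
have x1' := x1; have l1' := l1; have s1' := s1; have L' := L_ge.
move=> A0 Ss mS0 mS M2B hB.
have sp : 0 < s%:R :> R by lra.
have lp := mgf_radius_gt0 R; have k2 := mgf_const_ge0 R; have l8 := mgf_radius_le R.
have sV : s%:R^-1 <= 1 :> R by rewrite invf_le1.
set lam := mgf_radius / s%:R.
have lam0 : 0 < lam by rewrite divr_gt0.
have lam1 : lam <= mgf_radius by apply: ler_piMr => //; exact: ltW.
pose f (j : 'I_n) z := - lam * truncated t (m j + z).
have mf j : measurable_fun setT (f j).
  apply: measurable_funM => //; apply: (measurableT_comp (measurable_truncated t)).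
  exact: measurable_funD.
pose b (j : 'I_n) := if j \in S then - (lam * (M2 / 2 - signal_const * (1 + t ^+ 2)))
  else mgf_const * lam ^+ 2 * expR (- (t ^+ 2 / 8)).
have fb j : (\int[normal_prob 0 1]_z (expR (f j z))%:E <= (expR (b j))%:E)%E.
  rewrite /b /f; case: ifPn => jS.
    apply: (le_trans (truncated_signal_mgf (m j) t0 (l := lam) _)); first by rewrite ltW//=; lra.
    rewrite lee_fin ler_expR lerN2 ler_wpM2l ?(ltW lam0)//.
    by have := mS _ jS; lra.
  rewrite mS0// -[lam ^+ 2]sqrrN.
  under eq_integral do rewrite add0r.
  by apply: truncated_mgf => //; rewrite normrN gtr0_norm.
apply: le_trans (le_trans (noise_chernoff hE (- (lam * h)) Jr r0 mf fb) _).
  apply: le_measure; rewrite ?inE.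
  - apply: measurable_set_le.
    apply: (measurable_noise_sum hE r J (f := fun j z => truncated t (m j + z))) => j.
    apply: (measurableT_comp (measurable_truncated t)).
    exact: measurable_funD.
  - by apply: measurable_set_ge; exact: (measurable_noise_sum hE r J mf).
  - by move=> w /= hw; rewrite -mulr_sumr mulNr lerN2 ler_wpM2l// ltW.
rewrite lee_fin ler_expR.
have sumb : \sum_j b j <= - (lam * (M2 / 2 - signal_const * (1 + t ^+ 2))) * s%:R +
   n%:R * (mgf_const * lam ^+ 2 * expR (- (t ^+ 2 / 8))).
  rewrite (bigID (mem S))/=; apply: lerD.
    rewrite (eq_bigr (fun _ => - (lam * (M2 / 2 - signal_const * (1 + t ^+ 2))))).
      by rewrite sumr_const Ss mulr_natr.
    by move=> j jS; rewrite /b jS.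
  rewrite (eq_bigr (fun _ => mgf_const * lam ^+ 2 * expR (- (t ^+ 2 / 8)))); last first.
    by move=> j /negbTE jS; rewrite /b jS.
  rewrite sumr_const -[leLHS]mulr_natl ler_wpM2r//.
    exact: (mulr_ge0 (mulr_ge0 k2 (sqr_ge0 _)) (expR_ge0 _)).
  by rewrite ler_nat (leq_trans (max_card _))// card_ord.
have nv := ler_wpM2l (mulr_ge0 k2 (sqr_ge0 lam)) noise_var.
have key : mgf_const * lam ^+ 2 * (s%:R ^+ 2 / l) <= mgf_const * mgf_radius ^+ 2.
  have -> : mgf_const * lam ^+ 2 * (s%:R ^+ 2 / l) = mgf_const * mgf_radius ^+ 2 / l.
    by rewrite /lam; field; rewrite !gt_eqF//; lra.
  apply: ler_piMr; first exact: (mulr_ge0 k2 (sqr_ge0 _)).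
  by rewrite invf_le1; lra.
have h1 : lam * h <= lam * (B * (s%:R * L + l)) by rewrite ler_wpM2l// ltW.
have h2 : lam * (2 * (B + 10 * signal_const + tail_const A) * (s%:R * L + l)) <= lam * (s%:R * M2).
  by rewrite ler_wpM2l// ltW.
have K50 := signal_const_ge0 R.
(* 1 + t^2 = 1 + 8 L <= 10 L, because L >= 1/2. *)
have h3 : lam * s%:R * (signal_const * (1 + t ^+ 2)) <= lam * (10 * signal_const * (s%:R * L + l)).
  rewrite -mulrA ler_wpM2l ?(ltW lam0)//.
  have : signal_const * s%:R * (1 + t ^+ 2) <= signal_const * s%:R * (10 * L).
    by apply: ler_wpM2l; [exact: (mulr_ge0 K50 (ltW sp))|rewrite t2; lra].
  have : 0 <= signal_const * l by apply: mulr_ge0 => //; lra.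
  lra.
have HA := tail_const_ge0 A0.
have h4 : mgf_radius * tail_const A * (1 / 2) <= lam * (tail_const A * (s%:R * L + l)).
  have e : 1 / 2 <= s%:R^-1 * (s%:R * L + l).
    rewrite ler_pdivlMl//; have := ler_wpM2l (ltW sp) L_ge; lra.
  have := ler_wpM2l (mulr_ge0 (ltW lp) HA) e; rewrite /lam; lra.
have HE : mgf_radius * tail_const A * (1 / 2) = mgf_const * mgf_radius ^+ 2 + A.
  by rewrite /tail_const; field; rewrite gt_eqF.
lra.
Qed.
End trunc.

Section linear.
Variables (r : nat) (J : {set 'I_d1}).
Hypotheses (Jr : #|J| = r) (r0 : (0 < r)%N) (n0 : (0 < n)%N).

Let Z w := (Num.sqrt n%:R)^-1 * \sum_j sub_col_sum r J (E w) j.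

(** Each of the n columns contributes c^2/(2n) to the exponent, so the law of Z need not be
    computed. The level takes c = sqrt l, the power c = -1. *)
Let lin_tail (c a : R) : (P [set w | (a <= c * Z w)%R] <= (expR (c ^+ 2 / 2 - a))%:E)%E.
Proof.
have np : 0 < n%:R :> R by rewrite ltr0n.
set k := (Num.sqrt n%:R)^-1 : R.
pose f (j : 'I_n) z := c * k * z.
have mf j : measurable_fun setT (f j) by exact: measurable_funM.
have fb j : (\int[normal_prob 0 1]_z (expR (f j z))%:E <= (expR ((c * k) ^+ 2 / 2))%:E)%E.
  by rewrite normal_mgf.
apply: le_trans (le_trans (noise_chernoff hE a Jr r0 mf fb) _).
  rewrite [X in (P X <= _)%E](_ : _ = [set w | (a <= \sum_j f j (sub_col_sum r J (E w) j))%R])//.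
  by apply/seteqP; split => w /=; rewrite /f -mulr_sumr -mulrA.
rewrite lee_fin ler_expR lerB// sumr_const card_ord -mulr_natl exprMn /k exprVn.
rewrite sqr_sqrtr ?ler0n// le_eqVlt; apply/orP; left; apply/eqP.
by field; rewrite gt_eqF.
Qed.

Let mZ : measurable_fun setT Z.
Proof.
apply: measurable_funM => //.
exact: (measurable_noise_sum hE r J (f := fun _ => id)).
Qed.

Lemma null_lin A l h : 1 <= l -> (A + 1 / 2) * Num.sqrt l <= h ->
  (P [set w | (h < Z w)%R] <= (expR (- (A * l)))%:E)%E.
Proof.
move=> l1 hA; have l0 : 0 < l by lra.
have sl : 0 < Num.sqrt l by rewrite sqrtr_gt0.
apply: le_trans (le_trans (lin_tail (Num.sqrt l) (Num.sqrt l * h)) _).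
  apply: le_measure; rewrite ?inE.
  - exact: measurable_set_gt.
  - by apply: measurable_set_ge; exact: measurable_funM.
  - by move=> w /= hw; rewrite ler_wpM2l// ltW.
rewrite lee_fin ler_expR sqr_sqrtr ?(ltW l0)//.
have := ler_wpM2l (ltW sl) hA.
have -> : Num.sqrt l * ((A + 1 / 2) * Num.sqrt l) = (A + 1 / 2) * Num.sqrt l ^+ 2 by ring.
rewrite sqr_sqrtr ?(ltW l0)//; lra.
Qed.

Lemma alt_lin A theta h : A + 1 / 2 <= theta - h ->
  (P [set w | (theta + Z w <= h)%R] <= (expR (- A))%:E)%E.
Proof.
move=> hA.
apply: le_trans (le_trans (lin_tail (-1) (theta - h)) _).
  apply: le_measure; rewrite ?inE.
  - by apply: measurable_set_le; exact: measurable_funD.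
  - by apply: measurable_set_ge; exact: measurable_funM.
  - by move=> w /= hw; lra.
by rewrite lee_fin ler_expR sqrrN expr1n; lra.
Qed.
End linear.
End tails.

Section entropy.
Context (R : realType).
Implicit Types (d s : nat).

Lemma lbin_ge0 d s : (s <= d)%N -> 0 <= lbin d s :> R.
Proof. by move=> sd; rewrite ln_ge0// ler1n bin_gt0. Qed.

Lemma lebinE d s : (s <= d)%N -> lebin d s = 1 + lbin d s :> R.
Proof.
move=> sd; rewrite /lebin lnM ?posrE ?expR_gt0 ?ltr0n ?bin_gt0//.
by rewrite expRK.
Qed.

Lemma lebin_ge1 d s : (s <= d)%N -> 1 <= lebin d s :> R.
Proof. by move=> sd; rewrite lebinE// lerDl lbin_ge0. Qed.

Lemma bin_expR d s : (s <= d)%N -> ('C(d, s))%:R = expR (lebin d s - 1) :> R.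
Proof.
move=> sd; rewrite lebinE// addrC addKr lnK// posrE ltr0n bin_gt0//.
Qed.

End entropy.

(** * Cutoffs, level and power for a fixed set of rows *)

Section statistics.
Context (R : realType) d (T : measurableType d) (P : probability T R).
Context (d1 d2 : nat) (E : T -> 'M[R]_(d1, d2)).
Hypothesis hE : iid_entries P E.
Implicit Types (X Y : 'M[R]_(d1, d2)) (J : {set 'I_d1}).

Lemma sub_col_sumD s J X Y j :
  sub_col_sum s J (X + Y) j = sub_col_sum s J X j + sub_col_sum s J Y j.
Proof.
rewrite /sub_col_sum -mulrDr -big_split/=; congr (_ * _).
by apply: eq_bigr => i _; rewrite mxE.
Qed.

Lemma col_sumE Y j : col_sum Y j = sub_col_sum d1 [set: 'I_d1]%SET Y j.
Proof.
rewrite /col_sum /sub_col_sum; congr (_ * _).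
by apply: eq_bigl => i; rewrite inE.
Qed.

Lemma t_linE Y : t_lin Y =
  (Num.sqrt d2%:R)^-1 * \sum_j sub_col_sum d1 [set: 'I_d1]%SET Y j.
Proof.
rewrite /t_lin exchange_big/= sqrtrM ?ler0n// invfM [X in X * _]mulrC -mulrA.
congr (_ * _); rewrite mulr_sumr; apply: eq_bigr => j _.
by rewrite -col_sumE.
Qed.

Section cutoffs.
Variable A : R.
Hypothesis A0 : 0 <= A.

(** The level 1 + A leaves room for the union in [union_entropy]; [cut_lin] is likewise (1 + A) +
    1/2, as [null_lin] asks. *)
Definition cut_trunc : R := tail_const (1 + A).
Definition cut_lin : R := A + 3 / 2.
(** The requirement of [alt_trunc] with B = 3 [cut_trunc], a bound shared by the scanning cutoff and
    the larger constant of the non-scanning one. *)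
Definition signal_trunc : R := 2 * (3 * cut_trunc + 10 * signal_const R + tail_const A).
(** One constant for both regimes: 3 absorbs additive terms into the logarithm, and 8 (A + 1)^2 is 4
    (A + 1)^2 from squaring the linear separation, doubled by log(1 + x) >= x/2. *)
Definition signal : R := 3 * signal_trunc + 8 * (A + 1) ^+ 2.

Lemma cut_trunc_ge0 : 0 <= cut_trunc. Proof. by apply: tail_const_ge0; rewrite addr_ge0. Qed.

Lemma signal_trunc_ge0 : 0 <= signal_trunc.
Proof.
have h1 := cut_trunc_ge0; have h2 := signal_const_ge0 R; have h3 := tail_const_ge0 A0.
rewrite /signal_trunc; lra.
Qed.

Section family.
Variables (r s2 : nat) (l : R).
Hypotheses (r0 : (0 < r)%N) (s20 : (0 < s2 <= d2)%N) (l1 : 1 <= l).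
Let x : R := sratio s2 d2 * l.
Let L := ln (1 + x).
Let t := Num.sqrt (8 * L).

Let d20 : (0 < d2)%N. Proof. by have /andP[h1 h2] := s20; exact: leq_trans h2. Qed.
Let s2p : 0 < s2%:R :> R. Proof. by rewrite ltr0n; case/andP: s20. Qed.

Let x0 : 0 < x.
Proof.
rewrite /x mulr_gt0//; last exact: lt_le_trans l1.
by rewrite /sratio divr_gt0 ?exprn_gt0// ltr0n.
Qed.

Section alternative.
Variables (J : {set 'I_d1}) (X : 'M[R]_(d1, d2)) (S2 : {set 'I_d2}) (M h : R).
Hypotheses (Jr : #|J| = r) (S2s : #|S2| = s2) (M0 : 0 <= M).
Hypothesis XS : forall j, j \in S2 -> M <= sub_col_sum r J X j.
Hypothesis X0 : forall j, j \notin S2 -> sub_col_sum r J X j = 0.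

Lemma trunc_power : 1 <= x -> h <= 3 * cut_trunc * (s2%:R * L + l) ->
  signal_trunc * (s2%:R * L + l) <= s2%:R * M ^+ 2 ->
  (P [set w | (\sum_j truncated t (sub_col_sum r J (X + E w) j) <= h)%R] <=
   (expR (- A))%:E)%E.
Proof.
move=> x1 hh hM; have /andP[s2_gt0 _] := s20.
under eq_set do under eq_bigr do rewrite sub_col_sumD.
apply: (alt_trunc hE Jr r0 s2_gt0 l1 erefl x1 A0 S2s X0 (M2 := M ^+ 2)) hh => //.
by move=> j jS; rewrite lerXn2r ?nnegrE ?(le_trans M0)// XS.
Qed.

Lemma lin_power : h <= cut_lin * Num.sqrt l ->
  8 * (A + 1) ^+ 2 * L <= M ^+ 2 -> x <= 1 ->
  (P [set w | ((Num.sqrt d2%:R)^-1 * \sum_j sub_col_sum r J (X + E w) j <= h)%R] <=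
   (expR (- A))%:E)%E.
Proof.
move=> hh hM x1; have A0' := A0; have l1' := l1.
under eq_set do under eq_bigr do rewrite sub_col_sumD.
under eq_set do rewrite big_split mulrDr.
apply: (alt_lin hE Jr r0 d20).
set k := (Num.sqrt d2%:R)^-1.
have dp : 0 < d2%:R :> R by rewrite ltr0n.
have k0 : 0 < k by rewrite invr_gt0 sqrtr_gt0.
have k2 : k ^+ 2 = d2%:R^-1 by rewrite exprVn sqr_sqrtr// ltW.
have th : k * (s2%:R * M) <= k * \sum_j sub_col_sum r J X j.
  rewrite ler_wpM2l ?(ltW k0)// (bigID (mem S2))/= [X in _ + X]big1 ?addr0//.
  rewrite -S2s mulr_natl -sumr_const; exact: ler_sum.
have sl1 : 1 <= Num.sqrt l by rewrite -[leLHS]sqrtr1 ler_sqrt//; lra.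
(* After squaring, x = d_2 l/s_2^2 cancels the factor s_2^2/d_2. The margin over [cut_lin] is 2A + 2
   - (A + 3/2) = A + 1/2. *)
have main : (2 * A + 2) * Num.sqrt l <= k * (s2%:R * M).
  rewrite -(@ler_pXn2r _ 2)// ?nnegrE; last 2 first.
  - by apply: mulr_ge0; [lra|exact: sqrtr_ge0].
  - by rewrite !mulr_ge0// ltW.
  rewrite !exprMn k2 sqr_sqrtr; last lra.
  have Lx : x / 2 <= L by apply: ln1D_ge_lin; rewrite x1 ltW.
  have h1 : 8 * (A + 1) ^+ 2 * (x / 2) <= M ^+ 2.
    by apply: le_trans hM; rewrite ler_wpM2l// mulr_ge0// sqr_ge0.
  have c0 : 0 <= d2%:R^-1 * s2%:R ^+ 2 :> R by rewrite mulr_ge0 ?invr_ge0 ?sqr_ge0// ltW.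
  have := ler_wpM2l c0 h1.
  have -> : d2%:R^-1 * s2%:R ^+ 2 * (8 * (A + 1) ^+ 2 * (x / 2)) = 4 * (A + 1) ^+ 2 * l.
    by rewrite /x /sratio; field; rewrite !gt_eqF.
  by rewrite mulrA; lra.
have : (A + 1 / 2) * 1 <= (A + 1 / 2) * Num.sqrt l by rewrite ler_wpM2l//; lra.
by move: hh; rewrite /cut_lin; lra.
Qed.

End alternative.

Section null.
Variables (J : {set 'I_d1}) (h : R).
Hypothesis Jr : #|J| = r.

Lemma trunc_level : 1 <= x -> cut_trunc * (s2%:R * L + l) <= h ->
  (P [set w | (h < \sum_j truncated t (sub_col_sum r J (E w) j))%R] <=
   (expR (- ((1 + A) * l)))%:E)%E.
Proof.
move=> x1 hh; have /andP[s2_gt0 _] := s20.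
by apply: (null_trunc hE Jr r0 s2_gt0 l1 erefl x1) => //; rewrite addr_ge0.
Qed.

Lemma lin_level : cut_lin * Num.sqrt l <= h ->
  (P [set w | (h < (Num.sqrt d2%:R)^-1 * \sum_j sub_col_sum r J (E w) j)%R] <=
   (expR (- ((1 + A) * l)))%:E)%E.
Proof.
move=> hh; apply: (null_lin hE Jr r0 d20 l1).
by apply: le_trans hh; rewrite ler_wpM2r ?sqrtr_ge0// /cut_lin; lra.
Qed.

End null.
End family.
End cutoffs.
End statistics.

(** * Error probabilities of the tests *)

Section tests_risk.
Context (R : realType) d (T : measurableType d) (P : probability T R).
Context (d1 d2 : nat) (E : T -> 'M[R]_(d1, d2)).
Hypothesis hE : iid_entries P E.
Implicit Types (X Y : 'M[R]_(d1, d2)) (J : {set 'I_d1}).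
Variables (A : R) (s1 s2 : nat).
Hypotheses (A0 : 0 <= A) (s1d : (0 < s1 <= d1)%N) (s2d : (0 < s2 <= d2)%N).

Let s1_gt0 : (0 < s1)%N. Proof. by case/andP: s1d. Qed.
Let s1_le : (s1 <= d1)%N. Proof. by case/andP: s1d. Qed.
Let s2_gt0 : (0 < s2)%N. Proof. by case/andP: s2d. Qed.
Let d1_gt0 : (0 < d1)%N. Proof. exact: leq_trans s1_gt0 s1_le. Qed.

Let measurable_noise_gt J r (f : R -> R) h : measurable_fun setT f ->
  measurable [set w | h < \sum_j f (sub_col_sum r J (E w) j)].
Proof. by move=> mf; apply: measurable_set_gt; exact: (measurable_noise_sum hE r J (f := fun _ => f)). Qed.

Lemma measurable_test_set X (D : 'M[R]_(d1, d2) -> bool) :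
  measurable_fun setT D -> measurable [set w | ~~ D (X + E w)].
Proof.
move=> mD; have [mE _ _] := hE.
have mXE : measurable_fun setT (fun w => X + E w).
  apply: measurable_fun_mxP => i j; under eq_fun do rewrite mxE.
  by apply: measurable_funD.
rewrite (_ : [set w | _] = (fun w => D (X + E w)) @^-1` [set false]).
  by rewrite -[X in measurable X]setTI; apply: (measurableT_comp mD mXE).
by apply/seteqP; split => w /=; [move/negbTE|move=> ->].
Qed.

(** With l = [lebin d1 s1] there are exp(l - 1) row sets, and l - 1 - (1 + A) l <= -A since l >=
    1. *)
Let union_entropy (F : {set 'I_d1} -> set T) :
  (forall J, measurable (F J)) ->
  (forall J, #|J| = s1 -> (P (F J) <= (expR (- ((1 + A) * lebin d1 s1)))%:E)%E) ->
  (P [set w | exists2 J : {set 'I_d1}, #|J| == s1 & F J w] <= (expR (- A))%:E)%E.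
Proof.
move=> mF PF; pose Q := [set J : {set 'I_d1} | #|J| == s1]%SET.
rewrite (_ : [set w | _] = [set w | exists2 J : {set 'I_d1}, J \in Q & F J w]); last first.
  by apply/seteqP; split => w /= [J JQ FJ]; exists J => //; rewrite ?inE in JQ *.
apply: le_trans (union_bound (Q := mem Q) mF _) _.
  by move=> J; rewrite inE => /eqP; exact: PF.
rewrite card_draws card_ord bin_expR// -expRD lee_fin ler_expR.
have := @lebin_ge1 R _ _ s1_le; have A0' := A0 => l1.
have := ler_wpM2l A0 l1; lra.
Qed.

Lemma Delta_c_level h3 h4 :
  cut_trunc A * (s2%:R * ln (1 + sratio s2 d2 * lebin d1 s1) + lebin d1 s1) <= h3 ->
  cut_lin A * Num.sqrt (lebin d1 s1) <= h4 ->
  (P [set w | Delta_c 8 h3 h4 s1 s2 (E w)] <= (expR (- A))%:E)%E.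
Proof.
move=> hh3 hh4; have l1 := @lebin_ge1 R _ _ s1_le.
have [x1|x1] := boolP (1 <= sratio s2 d2 * lebin d1 s1 :> R).
  rewrite (_ : [set w | _] = [set w | exists2 J : {set 'I_d1}, #|J| == s1 &
    h3 < \sum_j truncated (tau_tilde 8 s1 d1 s2 d2) (sub_col_sum s1 J (E w) j)]).
    apply: union_entropy => [J|J Js].
      by apply: measurable_noise_gt; exact: measurable_truncated.
    exact: (trunc_level hE A0 s1_gt0 s2d l1 Js x1 hh3).
  apply/seteqP; split => w /=; rewrite /Delta_c x1.
    (* The discarded case is the default value -oo, which exceeds no real cutoff. *)
    by move=> /bigmax_gtP[//|[J Js]]; rewrite lte_fin => hJ; exists J.
  by move=> [J Js hJ]; apply/bigmax_gtP; right; exists J; rewrite ?lte_fin.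
rewrite (_ : [set w | _] = [set w | exists2 J : {set 'I_d1}, #|J| == s1 &
  h4 < (Num.sqrt d2%:R)^-1 * \sum_j sub_col_sum s1 J (E w) j]).
  apply: union_entropy => [J|J Js].
    apply: measurable_set_gt; apply: measurable_funM => //.
    exact: (measurable_noise_sum hE s1 J (f := fun _ => id)).
  exact: (lin_level hE s1_gt0 s2d l1 Js hh4).
apply/seteqP; split => w /=; rewrite /Delta_c (negbTE x1).
  by move=> /bigmax_gtP[//|[J Js]]; rewrite lte_fin => hJ; exists J.
by move=> [J Js hJ]; apply/bigmax_gtP; right; exists J; rewrite ?lte_fin.
Qed.

Lemma Delta_a_level h1 h2 :
  (1 <= sratio s2 d2 :> R ->
   cut_trunc A * (s2%:R * ln (1 + sratio s2 d2) + 1) <= h1) ->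
  cut_lin A <= h2 ->
  (P [set w | Delta_a 8 h1 h2 s2 (E w)] <= (expR (- A))%:E)%E.
Proof.
move=> hh1 hh2; have A0' := A0.
have cT : #|[set: 'I_d1]%SET| = d1 by rewrite cardsT card_ord.
have eA : ((expR (- ((1 + A) * 1)))%:E <= (expR (- A))%:E)%E.
  by rewrite lee_fin ler_expR; lra.
have [x1|x1] := boolP (1 <= sratio s2 d2 :> R).
  apply: le_trans eA; under eq_set do rewrite /Delta_a x1 /t_tr /tau.
  under eq_set do under eq_bigr do rewrite col_sumE.
  have := @trunc_level _ _ _ _ _ _ _ hE A A0 d1 s2 1 d1_gt0 s2d (lexx 1) _ h1 cT.
  by rewrite mulr1; apply => //; exact: hh1.
apply: le_trans eA; under eq_set do rewrite /Delta_a (negbTE x1) t_linE.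
apply: (lin_level hE d1_gt0 s2d (lexx 1) cT).
by rewrite sqrtr1 mulr1.
Qed.

Section power.
Variables (mu : R) (X : 'M[R]_(d1, d2)).
Hypotheses (mu0 : 0 < mu) (XT : Theta s1 s2 mu X).

(** Any J containing the support rows is allowed, to serve the scan (J = S1, r = s1) and the sums
    over all rows (r = d1). *)
Lemma Theta_col_sums : exists (S1 : {set 'I_d1}) (S2 : {set 'I_d2}),
  [/\ #|S1| = s1, #|S2| = s2 &
   forall J r, S1 \subset J ->
   (forall j, j \in S2 -> (Num.sqrt r%:R)^-1 * (s1%:R * mu) <= sub_col_sum r J X j) /\
   (forall j, j \notin S2 -> sub_col_sum r J X j = 0)].
Proof.
have [S1 [S2 [c1 c2 XS X0]]] := XT; exists S1, S2; split => // J r S1J.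
split => j jS; rewrite /sub_col_sum.
  rewrite ler_wpM2l ?invr_ge0 ?sqrtr_ge0// (big_setID S1)/= (finset.setIidPr S1J).
  rewrite [X in _ + X]big1 ?addr0.
    by rewrite -c1 mulr_natl -sumr_const ler_sum// => i iS; exact: XS.
  by move=> i; rewrite inE => /andP[/negbTE iS _]; rewrite X0// iS.
by rewrite big1 ?mulr0// => i _; rewrite X0// negb_and jS orbT.
Qed.

Let M (r : nat) : R := (Num.sqrt r%:R)^-1 * (s1%:R * mu).

Let M_ge0 r : 0 <= M r.
Proof. by rewrite /M mulr_ge0 ?invr_ge0 ?sqrtr_ge0// mulr_ge0// ltW. Qed.

Let M2 r : M r ^+ 2 = s1%:R ^+ 2 * mu ^+ 2 / r%:R.
Proof. by rewrite /M exprMn exprVn sqr_sqrtr// exprMn mulrC. Qed.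

Let signal_ge : 3 * signal_trunc A <= signal A /\ 8 * (A + 1) ^+ 2 <= signal A.
Proof.
have h1 := signal_trunc_ge0 A0; have h2 := sqr_ge0 (A + 1); rewrite /signal; lra.
Qed.

(** The indicator in beta_21 is x > 1, essentially the truncated branch, where the cutoff contains
    the entropy and s_1 s_2 beta_21 pays for it. The linear branch is carried by psi_12 alone. *)
Lemma Delta_c_power h3 h4 :
  h3 <= 3 * cut_trunc A * (s2%:R * ln (1 + sratio s2 d2 * lebin d1 s1) + lebin d1 s1) ->
  h4 <= cut_lin A * Num.sqrt (lebin d1 s1) ->
  signal A * (psi s1 d1 s2 d2 + beta s2 d2 s1 d1) <= mu ^+ 2 ->
  (P [set w | ~~ Delta_c 8 h3 h4 s1 s2 (X + E w)] <= (expR (- A))%:E)%E.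
Proof.
move=> hh3 hh4 hmu; have [sg1 sg2] := signal_ge.
have [S1 [S2 [c1 c2 /(_ S1 s1 (subxx _)) [XS X0]]]] := Theta_col_sums.
have l1 := @lebin_ge1 R _ _ s1_le.
have mD : measurable_fun setT (fun Y : 'M[R]_(d1, d2) => Delta_c 8 h3 h4 s1 s2 Y).
  exact: measurable_Delta_c.
have mS := measurable_test_set X mD.
have [mE _ _] := hE.
have mXE : measurable_fun setT (fun w => X + E w).
  apply: measurable_fun_mxP => i j; under eq_fun do rewrite mxE.
  by apply: measurable_funD.
have msub j : measurable_fun setT (fun w => sub_col_sum s1 S1 (X + E w) j).
  exact: (measurableT_comp (measurable_sub_col_sum s1 S1 j) mXE).
set x := sratio s2 d2 * lebin d1 s1 in hh3 *.
set L := ln (1 + x) in hh3.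
have s1p : 0 < s1%:R :> R by rewrite ltr0n.
have s2p : 0 < s2%:R :> R by rewrite ltr0n.
have x0 : 0 <= x by rewrite mulr_ge0 ?divr_ge0 ?sqr_ge0//; lra.
have L0 : 0 <= L by rewrite ln_ge0//; lra.
have M2E : M s1 ^+ 2 = s1%:R * mu ^+ 2 by rewrite M2; field; rewrite gt_eqF.
have psiE : psi s1 d1 s2 d2 = s1%:R^-1 * L :> R by [].
have b0 : 0 <= beta s2 d2 s1 d1 :> R.
  by rewrite /beta; case: ifP => // _; rewrite mulr_ge0 ?lbin_ge0// invr_ge0 mulr_ge0// ltW.
have sg0 : 0 <= signal A.
  by have := signal_trunc_ge0 A0; lra.
have hs := ler_wpM2l (ltW s1p) hmu.
have hsL : s1%:R * (signal A * psi s1 d1 s2 d2) = signal A * L.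
  by rewrite psiE; field; rewrite gt_eqF.
have [x1|x1] := boolP (1 <= x).
  apply: le_trans (trunc_power hE A0 s1_gt0 s2d l1 c1 c2 (M_ge0 s1) XS X0 x1 hh3 _).
    apply: le_measure; rewrite ?inE//.
      apply: measurable_set_le; apply: measurable_sum => j.
      apply: (measurableT_comp (measurable_truncated _)); exact: msub.
    (* A maximum below the cutoff bounds in particular the term of the support rows. *)
    move=> w /=; rewrite /Delta_c -/x x1 -leNgt => /bigmax_leP[_ /(_ S1)].
    by rewrite c1 eqxx lee_fin; apply.
  rewrite M2E.
  have L12 : 1 / 2 <= L by exact: ln1D_ge_half.
  have lE := @lebinE R _ _ s1_le.
  have lb0 := @lbin_ge0 R _ _ s1_le.
  have sL : s2%:R * (1 / 2) <= s2%:R * L by rewrite ler_wpM2l// ltW.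
  have s21 : 1 <= s2%:R :> R by rewrite ler1n.
  have hb : s2%:R * L + lebin d1 s1 <=
      3 * (s2%:R * L + s1%:R * s2%:R * beta s2 d2 s1 d1).
    rewrite /beta -/x; case: ifPn => [_|].
      have -> : s1%:R * s2%:R * ((s2%:R * s1%:R)^-1 * lbin d1 s1) = lbin d1 s1 :> R.
        by field; rewrite !gt_eqF.
      lra.
    (* Boundary case x = 1: the test is already truncated but the strict indicator is still off.
       Then d_2 >= s_2 forces the entropy below s_2, hence below 2 s_2 L. *)
    rewrite -leNgt => xle.
    have d2p : s2%:R <= d2%:R :> R by rewrite ler_nat; case/andP: s2d.
    suff : lebin d1 s1 <= s2%:R :> R by lra.
    have : s2%:R * lebin d1 s1 <= s2%:R * s2%:R :> R.
      apply: (@le_trans _ _ (d2%:R * lebin d1 s1)); first by rewrite ler_wpM2r//; lra.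
      have : s2%:R ^+ 2 * x <= s2%:R ^+ 2 * 1 by rewrite ler_wpM2l// sqr_ge0.
      have -> : s2%:R ^+ 2 * x = d2%:R * lebin d1 s1.
        by rewrite /x /sratio; field; rewrite gt_eqF.
      by rewrite mulr1 expr2.
    by rewrite ler_pM2l.
  have st0 := signal_trunc_ge0 A0.
  have h1 := ler_wpM2l st0 hb.
  have bb0 : 0 <= s2%:R * L + s1%:R * s2%:R * beta s2 d2 s1 d1.
    by rewrite addr_ge0 ?mulr_ge0// ltW.
  have h2 := ler_wpM2r bb0 sg1.
  have h3' := ler_wpM2l (ltW s2p) hs.
  have e3 : s2%:R * (s1%:R * (signal A * (psi s1 d1 s2 d2 + beta s2 d2 s1 d1))) =
     signal A * (s2%:R * L + s1%:R * s2%:R * beta s2 d2 s1 d1).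
    by rewrite psiE; field; rewrite gt_eqF.
  rewrite e3 in h3'.
  apply: le_trans (le_trans h1 _) h3'.
  lra.
apply: le_trans (lin_power hE A0 s1_gt0 s2d l1 c1 c2 (M_ge0 s1) XS X0 hh4 _ _).
- apply: le_measure; rewrite ?inE//.
    apply: measurable_set_le; apply: measurable_funM => //.
    by apply: measurable_sum => j; exact: msub.
  move=> w /=; rewrite /Delta_c -/x (negbTE x1) -leNgt => /bigmax_leP[_ /(_ S1)].
  by rewrite c1 eqxx lee_fin; apply.
- rewrite M2E -/L.
  have h1 := ler_wpM2r L0 sg2.
  have h2 : 0 <= s1%:R * (signal A * beta s2 d2 s1 d1) by rewrite !mulr_ge0// ltW.
  lra.
- by rewrite -/x; move: x1; rewrite -ltNge => /ltW.
Qed.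

Lemma Delta_a_power h1 h2 :
  h1 <= 3 * cut_trunc A * (s2%:R * ln (1 + sratio s2 d2) + 1) ->
  h2 <= cut_lin A ->
  signal A * phi s1 d1 s2 d2 <= mu ^+ 2 ->
  (P [set w | ~~ Delta_a 8 h1 h2 s2 (X + E w)] <= (expR (- A))%:E)%E.
Proof.
move=> hh1 hh2 hmu; have [sg1 sg2] := signal_ge.
have [S1 [S2 [c1 c2 /(_ [set: 'I_d1]%SET d1 (finset.subsetT _)) [XS X0]]]] := Theta_col_sums.
have cT : #|[set: 'I_d1]%SET| = d1 by rewrite cardsT card_ord.
have mD : measurable_fun setT (fun Y : 'M[R]_(d1, d2) => Delta_a 8 h1 h2 s2 Y).
  exact: measurable_Delta_a.
have mS := measurable_test_set X mD.
have [mE _ _] := hE.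
have mXE : measurable_fun setT (fun w => X + E w).
  apply: measurable_fun_mxP => i j; under eq_fun do rewrite mxE.
  by apply: measurable_funD.
have msub j : measurable_fun setT (fun w => sub_col_sum d1 [set: 'I_d1]%SET (X + E w) j).
  exact: (measurableT_comp (measurable_sub_col_sum d1 _ j) mXE).
set x := sratio s2 d2 in hh1 *.
set L := ln (1 + x) in hh1.
have s1p : 0 < s1%:R :> R by rewrite ltr0n.
have s2p : 0 < s2%:R :> R by rewrite ltr0n.
have d1p : 0 < d1%:R :> R by rewrite ltr0n.
have x0 : 0 <= x by rewrite divr_ge0 ?sqr_ge0.
have L0 : 0 <= L by rewrite ln_ge0//; lra.
(* Averaging over all rows turns mu^2 into s_1^2 mu^2/d_1, and the prefactor of phi_12 is the
   inverse of this loss. *)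
have hM : signal A * L <= M d1 ^+ 2.
  have c0 : 0 <= s1%:R ^+ 2 / d1%:R :> R by rewrite divr_ge0 ?sqr_ge0.
  have := ler_wpM2l c0 hmu; rewrite M2.
  have -> : s1%:R ^+ 2 / d1%:R * (signal A * phi s1 d1 s2 d2) = signal A * L.
    by rewrite /phi -/x -/L /sratio; field; rewrite !gt_eqF.
  by rewrite mulrAC.
have xE : x * 1 = x by rewrite mulr1.
have [x1|x1] := boolP (1 <= x).
  have x1' : 1 <= x * 1 by rewrite xE.
  have hh1' : h1 <= 3 * cut_trunc A * (s2%:R * ln (1 + x * 1) + 1) by rewrite xE.
  apply: le_trans (trunc_power hE A0 d1_gt0 s2d (lexx 1) cT c2 (M_ge0 d1) XS X0 x1' hh1' _).
    apply: le_measure; rewrite ?inE//.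
      apply: measurable_set_le; apply: measurable_sum => j.
      apply: (measurableT_comp (measurable_truncated _)); exact: msub.
    move=> w /=; rewrite /Delta_a -/x x1 -leNgt.
    have -> : t_tr 8 s2 (X + E w) = \sum_j truncated (tau 8 s2 d2)
        (sub_col_sum d1 [set: 'I_d1]%SET (X + E w) j).
      by apply: eq_bigr => j _; rewrite col_sumE.
    by rewrite /tau -/x xE.
  rewrite -/x xE -/L.
  have L12 : 1 / 2 <= L by exact: ln1D_ge_half.
  have s21 : 1 <= s2%:R :> R by rewrite ler1n.
  have sL : s2%:R * (1 / 2) <= s2%:R * L by rewrite ler_wpM2l// ltW.
  have hb : s2%:R * L + 1 <= 3 * (s2%:R * L) by lra.
  have q1 := ler_wpM2l (signal_trunc_ge0 A0) hb.
  have q2 := ler_wpM2r (mulr_ge0 (ltW s2p) L0) sg1.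
  have q3 := ler_wpM2l (ltW s2p) hM.
  apply: le_trans (le_trans q1 _) q3; lra.
have hh2' : h2 <= cut_lin A * Num.sqrt 1 by rewrite sqrtr1 mulr1.
have x1' : x * 1 <= 1 by rewrite xE; move: x1; rewrite -ltNge => /ltW.
apply: le_trans (lin_power hE A0 d1_gt0 s2d (lexx 1) cT c2 (M_ge0 d1) XS X0 hh2' _ x1').
  apply: le_measure; rewrite ?inE//.
    apply: measurable_set_le; apply: measurable_funM => //.
    by apply: measurable_sum => j; exact: msub.
  by move=> w /=; rewrite /Delta_a -/x (negbTE x1) -leNgt t_linE.
rewrite -/x xE -/L; apply: le_trans hM; exact: ler_wpM2r.
Qed.

End power.
End tests_risk.

(** * Comparison of the rates, transposition *)

Section rate_comparison.
Context (R : realType).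
Implicit Types s d : nat.

(** One term of the binomial theorem: binom(d, s) y^s <= (1 + y)^d <= exp(d y), at y = s/d. *)
Lemma lbin_le d s : (0 < s <= d)%N -> lbin d s <= s%:R * (1 + ln (d%:R / s%:R)) :> R.
Proof.
move=> /andP[s0 sd]; have sp : 0 < s%:R :> R by rewrite ltr0n.
have dp : 0 < d%:R :> R by rewrite ltr0n (leq_trans s0).
have bp : 0 < ('C(d, s))%:R :> R by rewrite ltr0n bin_gt0.
set y := s%:R / d%:R : R; have yp : 0 < y by rewrite divr_gt0.
have h1 : ('C(d, s))%:R * y ^+ s <= (1 + y) ^+ d.
  have sd1 : (s < d.+1)%N by rewrite ltnS.
  rewrite exprDn (bigD1 (Ordinal sd1))//= expr1n mul1r mulr_natl lerDl.
  by apply: sumr_ge0 => i _; rewrite mulrn_wge0// expr1n mul1r exprn_ge0// ltW.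
have h2 : (1 + y) ^+ d <= expR s%:R.
  have -> : s%:R = y * d%:R :> R by rewrite /y divfK// gt_eqF.
  rewrite expRM_natr lerXn2r ?nnegrE ?expR_ge0//; last exact: expR_ge1Dx.
  by rewrite addr_ge0// ltW.
have h3 := le_trans h1 h2.
rewrite /lbin -[leRHS]expRK ler_ln ?posrE ?expR_gt0//.
rewrite mulrDr mulr1 expRD expRM_natl lnK ?posrE ?divr_gt0//.
have -> : d%:R / s%:R = y^-1 :> R by rewrite /y invf_div.
by rewrite exprVn ler_pdivlMr// exprn_gt0.
Qed.

(** A large column entropy lifts psi_21 to log(1 + d_1/s_1)/s_2, the order of beta_21 by [lbin_le].
    The 3 comes from 1 <= 2 log(1 + y) for y >= 1. *)
Lemma beta_le d1 d2 s1 s2 : (0 < s1 <= d1)%N -> (0 < s2 <= d2)%N ->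
  s1%:R <= lebin d2 s2 :> R -> beta s2 d2 s1 d1 <= 3 * psi s2 d2 s1 d1 :> R.
Proof.
move=> hs1 hs2 hle; have /andP[s10 s1d] := hs1; have /andP[s20 s2d] := hs2.
have s1p : 0 < s1%:R :> R by rewrite ltr0n.
have s2p : 0 < s2%:R :> R by rewrite ltr0n.
have sd : s1%:R <= d1%:R :> R by rewrite ler_nat.
have y1 : 1 <= d1%:R / s1%:R :> R by rewrite ler_pdivlMr// mul1r.
set y := d1%:R / s1%:R in y1.
have l0 := @lbin_ge0 R _ _ s1d.
have psi_ge : s2%:R^-1 * ln (1 + y) <= psi s2 d2 s1 d1 :> R.
  have yl : y <= sratio s1 d1 * lebin d2 s2.
    have -> : y = sratio s1 d1 * s1%:R by rewrite /y /sratio; field; rewrite gt_eqF.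
    by rewrite ler_wpM2l// divr_ge0 ?sqr_ge0.
  rewrite /psi ler_wpM2l ?invr_ge0 ?(ltW s2p)// ler_ln ?posrE; lra.
have hb : beta s2 d2 s1 d1 <= (s2%:R * s1%:R)^-1 * lbin d1 s1 :> R.
  rewrite /beta; case: ifP => // _.
  by rewrite mulr_ge0// invr_ge0 mulr_ge0// ltW.
have h1 := @lbin_le _ _ hs1; rewrite -/y in h1.
have h2 : 1 + ln y <= 3 * ln (1 + y).
  have a1 : 1 / 2 <= ln (1 + y) by exact: ln1D_ge_half.
  have a2 : ln y <= ln (1 + y) by rewrite ler_ln ?posrE; lra.
  lra.
have h3 : (s2%:R * s1%:R)^-1 * lbin d1 s1 <= 3 * (s2%:R^-1 * ln (1 + y)).
  rewrite invfM -mulrA [leRHS]mulrCA ler_wpM2l ?invr_ge0 ?(ltW s2p)//.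
  rewrite ler_pdivrMl//; apply: le_trans h1 _; rewrite ler_wpM2l// ltW.
lra.
Qed.

(** When beta_21 is switched on it is at most 1/s_1 by the entropy bound, and its indicator gives
    psi_12 >= 1/(2 s_1). *)
Lemma beta_le_psi d1 d2 s1 s2 : (0 < s1 <= d1)%N -> (0 < s2 <= d2)%N ->
  lebin d1 s1 < s2%:R :> R -> beta s2 d2 s1 d1 <= 3 * psi s1 d1 s2 d2 :> R.
Proof.
move=> hs1 hs2 hle; have /andP[s10 s1d] := hs1; have /andP[s20 s2d] := hs2.
have s1p : 0 < s1%:R :> R by rewrite ltr0n.
have s2p : 0 < s2%:R :> R by rewrite ltr0n.
have l1 := @lebin_ge1 R _ _ s1d; have lE := @lebinE R _ _ s1d.
have s1i : 0 < s1%:R^-1 :> R by rewrite invr_gt0.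
rewrite /beta /psi; case: ifPn => [/ltW x1|_]; last first.
  rewrite mulr_ge0// mulr_ge0 ?(ltW s1i)// ln_ge0// lerDl mulr_ge0 ?divr_ge0 ?sqr_ge0//; lra.
have h := ln1D_ge_half x1.
have h1 : (s2%:R * s1%:R)^-1 * lbin d1 s1 <= s1%:R^-1 :> R.
  by rewrite invfM mulrAC ler_piMl ?(ltW s1i)// ler_pdivrMl//; lra.
have := ler_wpM2l (ltW s1i) h; lra.
Qed.

Lemma psi_ge0 s1 d1 s2 d2 : (s1 <= d1)%N -> 0 <= psi s1 d1 s2 d2 :> R.
Proof.
move=> sd; have l1 := @lebin_ge1 R _ _ sd.
by rewrite /psi mulr_ge0 ?invr_ge0// ln_ge0// lerDl mulr_ge0 ?divr_ge0 ?sqr_ge0//; lra.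
Qed.

Lemma phi_ge0 s1 d1 s2 d2 : 0 <= phi s1 d1 s2 d2 :> R.
Proof.
by rewrite /phi mulr_ge0 ?divr_ge0 ?sqr_ge0// ln_ge0// lerDl divr_ge0 ?sqr_ge0.
Qed.

Lemma Rtilde_le d1 d2 s1 s2 : (0 < s1 <= d1)%N -> (0 < s2 <= d2)%N ->
  Rtilde s1 d1 s2 d2 <= 4 * Num.min (psi s1 d1 s2 d2 + psi s2 d2 s1 d1)
    (Num.min (phi s1 d1 s2 d2) (phi s2 d2 s1 d1)) :> R.
Proof.
move=> hs1 hs2; have /andP[s10 s1d] := hs1; have /andP[s20 s2d] := hs2.
have p1 := @psi_ge0 s1 d1 s2 d2 s1d; have p2 := @psi_ge0 s2 d2 s1 d1 s2d.
have f1 := @phi_ge0 s1 d1 s2 d2; have f2 := @phi_ge0 s2 d2 s1 d1.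
rewrite /Rtilde !minr_pMr ?ler0n// !le_min !ge_min; apply/and3P; split; last 2 first.
- by apply/orP; right; apply/orP; right; apply/orP; left; lra.
- by apply/orP; right; apply/orP; right; apply/orP; right; lra.
(* Each case bounds one of the two mixed terms; 4 = 1 + 3 collects psi and the bound on beta. *)
have [c1|c1] := leP (s1%:R : R) (lebin d2 s2).
  by have := beta_le hs1 hs2 c1 => b; apply/orP; left; lra.
have [c2|c2] := leP (s2%:R : R) (lebin d1 s1).
  have := beta_le hs2 hs1 c2 => b; apply/orP; right; apply/orP; left; lra.
by have := beta_le_psi hs1 hs2 c2 => b; apply/orP; left; lra.
Qed.

End rate_comparison.

(** * Exchange of rows and columns *)

Section transpose.
Context (R : realType) d (T : measurableType d) (P : probability T R).
Context (d1 d2 : nat).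

Lemma iid_entries_tr (E : T -> 'M[R]_(d1, d2)) :
  iid_entries P E -> iid_entries P (fun w => (E w)^T).
Proof.
move=> [mE lE iE]; split.
- by move=> i j; under eq_fun do rewrite mxE; exact: mE.
- by move=> i j B mB; under eq_set do rewrite mxE; exact: lE.
move=> J B mB.
pose sw (k : 'I_d2 * 'I_d1) := (k.2, k.1).
pose sw' (k : 'I_d1 * 'I_d2) := (k.2, k.1).
have := iE (sw' @^-1: J)%SET (fun k => B (sw' k)) (fun k => mB (sw' k)).
rewrite (_ : [set w | forall k, _ -> _] =
  [set w | forall k, k \in J -> B k ((E w)^T k.1 k.2)]); last first.
  apply/seteqP; split => w /= hw [i j].
    by move=> kJ; rewrite mxE; apply: (hw (j, i)); rewrite inE.
  by rewrite inE /= => kJ; have := hw _ kJ; rewrite mxE.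
move=> ->; rewrite (reindex sw)/=; last first.
  by exists sw' => [[i j] _|[i j] _].
apply: eq_big => [[i j]|[i j] _]; first by rewrite inE.
by congr (P _); apply/seteqP; split => w /=; rewrite mxE.
Qed.

Lemma Theta_tr s1 s2 (mu : R) (X : 'M[R]_(d1, d2)) :
  Theta s1 s2 mu X -> Theta s2 s1 mu X^T.
Proof.
move=> [S1 [S2 [c1 c2 XS X0]]]; exists S2, S1; split => // i j.
  by move=> iS jS; rewrite mxE XS.
by rewrite andbC mxE => ij; rewrite X0.
Qed.

End transpose.

(** * Risk of the test *)

Section risk_bound.
Context (R : realType) d (T : measurableType d) (P : probability T R).
Context (d1 d2 : nat) (E : {RV P >-> 'M[R]_(d1, d2)}).

Lemma iid_std_normal_entries : iid_std_normal E -> iid_entries P E.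
Proof.
move=> [lE iE]; split => // i j.
exact: (measurableT_comp (measurable_entry i j)).
Qed.

Lemma risk_le s1 s2 (Delta : {mfun 'M[R]_(d1, d2) >-> bool}) (mu e : R) :
  (P [set w | Delta (E w)] <= e%:E)%E ->
  (forall X, Theta s1 s2 mu X -> (P [set w | ~~ Delta (X + E w)%R] <= e%:E)%E) ->
  (risk E s1 s2 Delta mu <= (e + e)%:E)%E.
Proof.
move=> level power; rewrite /risk EFinD leeD//.
  apply: le_trans level; rewrite le_eqVlt; apply/orP; left; apply/eqP.
  rewrite /law /distribution /pushforward; congr (P _).
  by apply/seteqP; split => w /=; rewrite /observation add0r.
apply: ge_ereal_sup => _ [X XT <-]; apply: le_trans (power X XT).
rewrite le_eqVlt; apply/orP; left; apply/eqP.
rewrite /law /distribution /pushforward; congr (P _).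
by apply/seteqP; split => w /=; rewrite /observation; [move=> ->|move/negbTE].
Qed.

End risk_bound.

Section cutoff_signs.
Context (R : realType).
Implicit Type A : R.

Lemma cut_trunc_gt0 A : 0 <= A -> 0 < cut_trunc A.
Proof.
move=> A0; have lp := mgf_radius_gt0 R; have k2 := mgf_const_ge0 R.
have h1 : 0 <= mgf_const R * mgf_radius R by exact: (mulr_ge0 k2 (ltW lp)).
have h2 : 0 < (1 + A) / mgf_radius R by apply: divr_gt0 => //; lra.
rewrite /cut_trunc /tail_const; lra.
Qed.

Lemma cut_lin_gt0 A : 0 <= A -> 0 < cut_lin A.
Proof. by rewrite /cut_lin; lra. Qed.

Lemma signal_gt0 A : 0 <= A -> 0 < signal A.
Proof.
move=> A0; have h1 := signal_trunc_ge0 A0.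
have h2 : 0 < (A + 1) ^+ 2 by rewrite exprn_gt0//; lra.
rewrite /signal; lra.
Qed.

(** Unlike h_3, the cutoff h_1 has no additive term; since s log(1 + x) >= 1/2, tripling the
    constant makes up for the missing 1. *)
Lemma trunc_cutoff_a A (d s : nat) : 0 <= A -> (0 < s)%N -> 1 <= sratio s d :> R ->
  cut_trunc A * (s%:R * ln (1 + sratio s d) + 1) <=
  3 * cut_trunc A * (s%:R * ln (1 + sratio s d)).
Proof.
move=> A0 s0 x1; have c0 := cut_trunc_gt0 A0.
have L := ln1D_ge_half x1; have s1 : 1 <= s%:R :> R by rewrite ler1n.
have sL : s%:R * (1 / 2) <= s%:R * ln (1 + sratio s d) :> R by rewrite ler_wpM2l//; lra.
have h : s%:R * ln (1 + sratio s d) + 1 <= 3 * (s%:R * ln (1 + sratio s d)) :> R by lra.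
have := ler_wpM2l (ltW c0) h; lra.
Qed.

End cutoff_signs.

Theorem proposition1 (R : realType) (eta : R) (eta_gt0 : 0 < eta) (eta_lt1 : eta < 1) :
  exists C Ch1 Ch1' Ch2 Ch3 Ch3' Ch4 Ch4' Ct1 Ct2 Cm1 Cm2 : R,
    [/\ 0 < C,
        [/\ 0 < Ch1, 0 < Ch1', 0 < Ch2 & 0 < Ch3],
        [/\ 0 < Ch3', 0 < Ch4 & 0 < Ch4'],
        [/\ 0 < Ct1, 0 < Ct2, 0 < Cm1 & 0 < Cm2] &
    forall (d1 d2 s1 s2 : nat) (mu : R),
      (0 < s1 <= d1)%N -> (0 < s2 <= d2)%N -> 0 < mu ->
      C * Num.min (psi s1 d1 s2 d2 + psi s2 d2 s1 d1)
                  (Num.min (phi s1 d1 s2 d2) (phi s2 d2 s1 d1)) <= mu ^+ 2 ->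
    forall (d : measure_display) (T : measurableType d) (P : probability T R)
      (E : {RV P >-> 'M[R]_(d1, d2)}),
      iid_std_normal E ->
      let h1 := Ch1 * (s2%:R * ln (1 + sratio s2 d2)) in
      let h1' := Ch1' * (s1%:R * ln (1 + sratio s1 d1)) in
      let h2 := Ch2 in
      let h3 := Ch3 * (s2%:R * ln (1 + sratio s2 d2 * lebin d1 s1) + lebin d1 s1) in
      let h3' := Ch3' * (s1%:R * ln (1 + sratio s1 d1 * lebin d2 s2) + lebin d2 s2) in
      let h4 := Ch4 * Num.sqrt (lebin d1 s1) in
      let h4' := Ch4' * Num.sqrt (lebin d2 s2) in
      (risk E s1 s2
         (Delta_star Ct1 Ct2 Cm1 Cm2 h1 h1' h2 h2 h3 h3' h4 h4' s1 s2) mu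
       <= eta%:E)%E].
Proof.
pose A := ln (2 / eta).
have A0 : 0 <= A by rewrite ln_ge0// ler_pdivlMr//; lra.
have eE : expR (- A) = eta / 2.
  by rewrite expRN lnK ?invf_div// posrE divr_gt0.
have c0 := cut_trunc_gt0 A0; have l0 := cut_lin_gt0 A0; have sg0 := signal_gt0 A0.
(* The 4 is the loss in [Rtilde_le], the 3 that of [trunc_cutoff_a]. *)
exists (4 * signal A), (3 * cut_trunc A), (3 * cut_trunc A), (cut_lin A),
  (cut_trunc A), (cut_trunc A), (cut_lin A), (cut_lin A), 8, 8, 8, 8.
split => //.
- by rewrite mulr_gt0.
- by split => //; rewrite mulr_gt0.
move=> d1 d2 s1 s2 mu hs1 hs2 mu0 hmu d T P E hE; cbv zeta.
have iE := iid_std_normal_entries hE; have iEt := iid_entries_tr iE.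
have /andP[s10 s1d] := hs1; have /andP[s20 s2d] := hs2.
have hR : signal A * Rtilde s1 d1 s2 d2 <= mu ^+ 2.
  apply: le_trans hmu; rewrite [4 * _]mulrC -mulrA ler_wpM2l ?(ltW sg0)//.
  exact: Rtilde_le.
have cut_a (d' s' : nat) : 3 * cut_trunc A * (s'%:R * ln (1 + sratio s' d')) <=
    3 * cut_trunc A * (s'%:R * ln (1 + sratio s' d') + 1).
  by rewrite ler_wpM2l ?lerDl// mulr_ge0// ltW.
have cut_c (x l : R) (s' : nat) : 0 <= x -> 0 <= l ->
  cut_trunc A * (s'%:R * ln (1 + x) + l) <= 3 * cut_trunc A * (s'%:R * ln (1 + x) + l).
  move=> x0 l_0; have X0 : 0 <= s'%:R * ln (1 + x) + l.
    by rewrite addr_ge0// mulr_ge0// ln_ge0// lerDl.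
  have := mulr_ge0 (ltW c0) X0; lra.
have ratio_ge0 s d' : 0 <= sratio s d' :> R by rewrite divr_ge0 ?sqr_ge0.
have lb1 : 0 <= lebin d1 s1 :> R by apply: le_trans (lebin_ge1 R s1d).
have lb2 : 0 <= lebin d2 s2 :> R by apply: le_trans (lebin_ge1 R s2d).
rewrite [eta]splitr -eE; apply: risk_le => /=; rewrite /Delta_star.
  have [_|_] := eqVneq; first by apply: (Delta_a_level iE A0 hs1 hs2) => // x1; exact: trunc_cutoff_a.
  have [_|_] := eqVneq; first by apply: (Delta_a_level iEt A0 hs2 hs1) => // x1; exact: trunc_cutoff_a.
  have [_|_] := eqVneq; first exact: (Delta_c_level iE A0 hs1 hs2).
  exact: (Delta_c_level iEt A0 hs2 hs1).
move=> X XT; have XTt := Theta_tr XT.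
have trE w : (X + E w)^T = X^T + (E w)^T by exact: linearD.
have [R1|R1] := eqVneq.
  by apply: (Delta_a_power iE A0 hs1 hs2 mu0 XT) => //; rewrite -R1.
have [R2|R2] := eqVneq.
  under eq_set do rewrite trE.
  by apply: (Delta_a_power iEt A0 hs2 hs1 mu0 XTt) => //; rewrite -R2.
have [R3|R3] := eqVneq.
  apply: (Delta_c_power iE A0 hs1 hs2 mu0 XT) => //; last by rewrite -R3.
  by apply: cut_c => //; exact: mulr_ge0.
under eq_set do rewrite trE.
apply: (Delta_c_power iEt A0 hs2 hs1 mu0 XTt) => //.
  by apply: cut_c => //; exact: mulr_ge0.
(* A minimum is attained by one of its four terms, and the failed comparisons rule out the other
   three. *)
suff <- : Rtilde s1 d1 s2 d2 = psi s2 d2 s1 d1 + beta s1 d1 s2 d2 :> R by [].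
move: R1 R2 R3; rewrite /Rtilde.
have minE (a b : R) : Num.min a b = a \/ Num.min a b = b by case: leP; [left|right].
set a := psi s1 d1 s2 d2 + _; set b := psi s2 d2 s1 d1 + _.
set c := phi s1 d1 s2 d2; set e := phi s2 d2 s1 d1.
have [->|->] := minE a (Num.min b (Num.min c e)); first by rewrite eqxx.
have [->|->] := minE b (Num.min c e) => //.
by have [->|->] := minE c e; rewrite eqxx.
Qed.
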